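(* Let $G$ be a finite group, let $n$ be a positive integer, let $1\leq p\leq 2$, let $0<\varepsilon\leq 1/4$ and let $f:G\to U(n)$ be an affine $\varepsilon$-representation with respect to $\|\cdot\|_p'$. Then there exist an integer $m\in[(1-2^{2-p}\varepsilon^p)n,(1-2^{2-p}\varepsilon^p)^{-1}n]$ and an $(n,m)$-partial affine representation $\rho$ of $G$ such that \[\|f(x)-\rho(x)\|_p'\leq(1+3\cdot 2^{3/p-1}+2C_p)\varepsilon\] for every $x\in G$, where $C_p=(2^{5-p}+2^{2-p})^{1/p}$.
   Context: For $A\in M_n(\mathbb{C})$ with singular values $\lambda_1,\dots,\lambda_n$, the normalized Schatten $p$-norm is $\|A\|_p'=\left(\frac1n\sum_{i=1}^n\lambda_i^p\right)^{1/p}$. A map $f:G\to U(n)$ is an affine $\varepsilon$-representation with respect to $\|\cdot\|_p'$ if $\|f(x)f(y)^*f(z)f(w)^*-I_n\|_p'\leq\varepsilon$ for all $x,y,z,w\in G$ with $xy^{-1}zw^{-1}=e$. An $n\times m$ complex matrix is a partial unitary matrix if its rows are orthonormal when $n\leq m$ and its columns are orthonormal when $n\geq m$. An $(n,m)$-partial affine representation of $G$ is a function $\rho:G\to M_n(\mathbb{C})$ of the form $\rho(x)=VP(x)U^*$, where $U$ and $V$ are $n\times m$ partial unitary matrices and $P:G\to U(m)$ is a unitary representation. *)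

(* Defs.v *)
From HB Require Import structures.
From mathcomp Require Import all_boot all_order all_algebra all_fingroup.
From mathcomp Require Import sesquilinear spectral mxrepresentation.
From mathcomp Require Import complex.
From mathcomp Require Import reals exp.

Set Implicit Arguments.
Unset Strict Implicit.
Unset Printing Implicit Defensive.

Import Order.TTheory GRing.Theory Num.Theory.
Local Open Scope ring_scope.
Local Open Scope complex_scope.
Local Open Scope sesquilinear_scope.

Section Schatten.
Variable R : realType.

(* [spectral_diag M] lists the eigenvalues of a normal matrix [M] with
   multiplicity; [A^t* *m A] is positive semidefinite, so these eigenvalues are
   nonnegative reals and taking the real part loses nothing. *)
Definition singular_value (n : nat) (A : 'M[R[i]]_n) (i : 'I_n) : R :=
  Num.sqrt (complex.Re (spectral_diag (A^t* *m A) 0 i)).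

Definition nschatten (p : R) (n : nat) (A : 'M[R[i]]_n) : R :=
  (n%:R^-1 * \sum_(i < n) singular_value A i `^ p) `^ p^-1.

(* For [m <= n] the condition is [U^* U = 1], i.e. orthonormal columns of [U],
   stated as orthonormality of the rows of [U^*]. *)
Definition partial_unitary (n m : nat) (U : 'M[R[i]]_(n, m)) : Prop :=
  ((n <= m)%N -> U \is unitarymx) /\ ((m <= n)%N -> U^t* \is unitarymx).

Variable G : finGroupType.

Definition affine_eps_representation (p eps : R) (n : nat)
    (f : G -> 'M[R[i]]_n) : Prop :=
  (forall x, f x \is unitarymx) /\
  (forall x y z w : G, (x * y^-1 * z * w^-1 = 1)%g ->
     nschatten p (f x *m (f y)^t* *m f z *m (f w)^t* - 1%:M) <= eps).

Definition partial_affine_representation (n m : nat)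
    (rho : G -> 'M[R[i]]_n) : Prop :=
  exists (U V : 'M[R[i]]_(n, m)) (P : mx_representation R[i] [set: G] m),
    [/\ partial_unitary U, partial_unitary V,
        (forall x, P x \is unitarymx) &
        (forall x, rho x = V *m P x *m U^t*)].

End Schatten.

(* Main.v *)
(* Let h(u) be the average of f(uy) f(z^-1 y)^* f(z^-1) over y, z; convexity of the
   norm gives |f - h| <= eps.  Convolution by f is a contraction F of l^2(G) (x) C^n
   commuting with the translations T(x), and if J denotes sqrt |G| times the inclusion
   of C^n at the identity of G, then h(x) = J^* T(x) F F^* F J, while both
   J^* F F^* J and J^* F^* F J are 1.  If d_j are the eigenvalues of F^* F, then
   sum d_j = n, and the affine relation gives sum d_j^2 >= n (1 - delta / 2) with
   delta = 2^(2-p) eps^p: the d_j are concentrated near 0 and 1.  The span of the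
   eigenvectors with d_j > 1/2 is invariant and carries a unitary representation P of
   dimension m close to n.  Replacing F^* F by the projection on this span, and then
   the compressions of J^* F and J^* to it by their polar parts V and U, changes h
   into V P U^* at the cost of three errors, each of operator norm at most 1 and trace
   norm at most delta n.
   For p >= 1 the sum of the p-th powers of the singular values of X is the maximum of
   sum_i |(A X B)_ii|^p over unitary A, B, so only diagonal entries ever have to be
   estimated; this yields the bound eps + 3 delta^(1/p). *)
Require Import Defs.
From mathcomp Require Import all_boot all_order all_algebra all_fingroup.
From mathcomp Require Import sesquilinear spectral mxrepresentation.
From mathcomp Require Import complex reals exp.
From mathcomp Require Import ring lra.

Set Implicit Arguments.
Unset Strict Implicit.
Unset Printing Implicit Defensive.

Import Order.TTheory GRing.Theory Num.Theory.
Local Open Scope ring_scope.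
Local Open Scope sesquilinear_scope.

(** * Contractions *)

Section Contractions.
Variable C : numClosedFieldType.

Lemma adjmxM m n p (A : 'M[C]_(m, n)) (B : 'M[C]_(n, p)) :
  (A *m B)^t* = B^t* *m A^t*.
Proof. by rewrite trmx_mul map_mxM. Qed.

Lemma adjmxB m n (A B : 'M[C]_(m, n)) : (A - B)^t* = A^t* - B^t*.
Proof. by rewrite linearB /= map_mxB. Qed.

Lemma adjmxZ m n (a : C) (A : 'M[C]_(m, n)) : (a *: A)^t* = a^* *: A^t*.
Proof. by rewrite linearZ /= map_mxZ. Qed.

Lemma adjmx_sum m n (I : finType) (F : I -> 'M[C]_(m, n)) :
  (\sum_i F i)^t* = \sum_i (F i)^t*.
Proof.
apply/matrixP=> i j; rewrite !mxE !summxE raddf_sum; apply: eq_bigr => k _.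
by rewrite !mxE.
Qed.

Lemma adjmxE m n (A : 'M[C]_(m, n)) i j : (A^t*) i j = (A j i)^*.
Proof. by rewrite !mxE. Qed.

Lemma adjmx1 n : (1%:M : 'M[C]_n)^t* = 1%:M.
Proof. by rewrite trmx1 map_mx1. Qed.

(** The squared Euclidean length: with no root taken, it is a diagonal entry of [A *m A^t*]. *)
Definition rownorm m n (A : 'M[C]_(m, n)) i : C := \sum_j `|A i j| ^+ 2.

Lemma mulmx_adjE m n (A : 'M[C]_(m, n)) i : (A *m A^t*) i i = rownorm A i.
Proof. by rewrite !mxE; apply: eq_bigr => j _; rewrite !mxE normCK. Qed.

Lemma rownorm_ge0 m n (A : 'M[C]_(m, n)) i : 0 <= rownorm A i.
Proof. by apply: sumr_ge0 => j _; rewrite exprn_ge0. Qed.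

Lemma rownorm_adj m n (A : 'M[C]_(m, n)) j :
  rownorm (A^t*) j = \sum_i `|A i j| ^+ 2.
Proof. by apply: eq_bigr => i _; rewrite adjmxE norm_conjC. Qed.

Lemma sum_rownorm_adj m n (A : 'M[C]_(m, n)) :
  \sum_j rownorm (A^t*) j = \sum_i rownorm A i.
Proof. by under eq_bigr do rewrite rownorm_adj; rewrite exchange_big. Qed.

Lemma mxtrace_mulmx_adj m n (A : 'M[C]_(m, n)) :
  \tr (A *m A^t*) = \sum_i rownorm A i.
Proof. by apply: eq_bigr => i _; rewrite mulmx_adjE. Qed.

(** Operator norm at most 1, for the action on row vectors. Ranging over all [k] lets it apply to
    every row of a matrix product at once. *)
Definition contraction m n (A : 'M[C]_(m, n)) : Prop :=
  forall k (v : 'M[C]_(k, m)) i, rownorm (v *m A) i <= rownorm v i.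

Lemma unitarymx_rownorm k m n (v : 'M[C]_(k, m)) (A : 'M[C]_(m, n)) i :
  A \is unitarymx -> rownorm (v *m A) i = rownorm v i.
Proof.
by move=> /unitarymxP AA; rewrite -!mulmx_adjE adjmxM mulmxA -(mulmxA v) AA mulmx1.
Qed.

Lemma unitarymx_contraction m n (A : 'M[C]_(m, n)) :
  A \is unitarymx -> contraction A.
Proof. by move=> AU k v i; rewrite unitarymx_rownorm. Qed.

Lemma contractionM m n p (A : 'M[C]_(m, n)) (B : 'M[C]_(n, p)) :
  contraction A -> contraction B -> contraction (A *m B).
Proof.
by move=> cA cB k v i; rewrite mulmxA; apply: le_trans (cB _ _ _) (cA _ _ _).
Qed.

Lemma rownormB m n (v w : 'M[C]_(m, n)) i :
  rownorm (v - w) i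
    = rownorm v i + rownorm w i - ((v *m w^t*) i i + (w *m v^t*) i i).
Proof.
rewrite -!mulmx_adjE adjmxB mulmxBl !mulmxBr !mxE; ring.
Qed.

(* Expanding [0 <= |v - v A^* A|^2] gives
   [2 |v A^*|^2 <= |v|^2 + |v A^* A|^2 <= |v|^2 + |v A^*|^2]. *)
Lemma contraction_adj m n (A : 'M[C]_(m, n)) :
  contraction A -> contraction (A^t*).
Proof.
move=> cA k v i; have := rownorm_ge0 (v - v *m A^t* *m A) i.
have E : v *m (v *m A^t* *m A)^t* = v *m A^t* *m (v *m A^t*)^t*.
  by rewrite !adjmxM trmxCK !mulmxA.
have E' : v *m A^t* *m A *m v^t* = v *m A^t* *m (v *m A^t*)^t*.
  by rewrite !adjmxM trmxCK !mulmxA.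
rewrite rownormB E E' mulmx_adjE.
have := cA _ (v *m A^t*) i; set a := rownorm (_ *m A) i.
move=> H1 H2; rewrite -subr_ge0; apply: le_trans H2 _.
rewrite -subr_ge0; move: H1; rewrite -subr_ge0 => H1.
by apply: le_trans H1 _; rewrite le_eqVlt; apply/orP; left; apply/eqP; ring.
Qed.

(** The variance identity; nonnegativity of the left side is the Cauchy-Schwarz inequality used in
    [contraction_avg]. *)
Lemma normB_sum (I : finType) (z : I -> C) :
  \sum_a \sum_b `|z a - z b| ^+ 2
    = (#|I|%:R * \sum_a `|z a| ^+ 2 - `|\sum_a z a| ^+ 2) *+ 2.
Proof.
under eq_bigr => a _ do under eq_bigr => b _ do
  rewrite normCK rmorphB mulrBl !mulrBr -!normCK.
under eq_bigr do rewrite !sumrB.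
rewrite !sumrB sumr_const.
under [X in _ - X - _]eq_bigr do rewrite -mulr_sumr -rmorph_sum.
rewrite -mulr_suml.
under [X in _ - (X - _)]eq_bigr do rewrite -mulr_suml.
rewrite -mulr_sumr -rmorph_sum.
under [X in X - _ - _]eq_bigr do rewrite sumr_const.
rewrite sumrMnl -normCK.
set s := \sum_i `|z i| ^+ 2; set t := `|_| ^+ 2.
rewrite -mulr_natl.
ring.
Qed.

Lemma contraction_avg (I : finType) m n (U : I -> 'M[C]_(m, n)) :
  (0 < #|I|)%N -> (forall a, contraction (U a)) ->
  contraction (#|I|%:R^-1 *: \sum_a U a).
Proof.
move=> I0 cU k v i; have I0' : 0 < (#|I|%:R : C) by rewrite ltr0n.
suff: rownorm (\sum_a v *m U a) i <= #|I|%:R ^+ 2 * rownorm v i.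
  rewrite -ler_pdivrMl ?exprn_gt0 //; apply: le_trans.
  rewrite -scalemxAr -mulmx_sumr /rownorm mulr_sumr ler_sum // => j _.
  by rewrite mxE normrM exprMn normfV normr_nat exprVn.
apply: (@le_trans _ _ (#|I|%:R * \sum_a rownorm (v *m U a) i)).
  rewrite [X in _ <= _ * X]exchange_big mulr_sumr ler_sum // => j _.
  rewrite summxE -subr_ge0 -(@pmulrn_lge0 _ _ 2) // -normB_sum.
  by do 2![apply: sumr_ge0 => ? _]; rewrite exprn_ge0.
rewrite expr2 -mulrA ler_pM2l //.
apply: (@le_trans _ _ (\sum_(a : I) rownorm v i)); first by apply: ler_sum => a _;
  exact: cU.
by rewrite sumr_const mulr_natl.
Qed.

(** Induction on the size of [Z], which indexes the zero rows of [Y]: each of them is replaced by a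
    unit vector orthogonal to all other rows. *)
Lemma unitarymx_extend n m (Y : 'M[C]_(n, m)) (Z : {set 'I_n}) :
  (n <= m)%N ->
  (forall i j, (Y *m Y^t*) i j = ((i == j) && (i \notin Z))%:R) ->
  exists2 Q : 'M[C]_(n, m), Q \is unitarymx &
    forall i, i \notin Z -> row i Q = row i Y.
Proof.
move=> nm; have [k] := ubnP #|Z|; elim: k Y Z => // k IH Y Z.
rewrite ltnS => Zk YY.
have [Z0|[i0 i0Z]] := set_0Vmem Z.
  exists Y => //; apply/unitarymxP/matrixP => i j.
  by rewrite YY Z0 inE andbT !mxE.
have Y0 : row i0 Y = 0.
  apply/rowP => j; rewrite !mxE; have := YY i0 i0.
  rewrite eqxx i0Z mulmx_adjE => /psumr_eq0P H.
  by apply/eqP; rewrite -normr_eq0 -sqrf_eq0 H // => l _; rewrite exprn_ge0.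
have rY : (\rank Y < n)%N.
  rewrite ltn_neqAle rank_leq_row andbT; apply/negP => fY.
  have : delta_mx (0 : 'I_1) i0 *m Y = 0 *m Y by rewrite -rowE Y0 mul0mx.
  move/(row_free_inj fY)/matrixP/(_ 0 i0); rewrite !mxE !eqxx /=.
  by move/eqP; rewrite oner_eq0.
(* The rank of [Y] is below [n <= m], so some nonzero vector is orthogonal to all its rows. *)
have kY : kermx (Y^t*) != 0.
  by rewrite kermx_eq0 /row_free mxrank_map mxrank_tr
             neq_ltn (leq_trans rY nm).
pose u := nz_row (kermx (Y^t*)).
have u0 : u != 0 by rewrite nz_row_eq0.
have uY : u *m Y^t* = 0 by apply/sub_kermxP; exact: nz_row_sub.
have nu : 0 < rownorm u 0.
  rewrite lt_neqAle rownorm_ge0 andbT eq_sym; apply: contra u0 => /eqP.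
  move=> /psumr_eq0P H; apply/eqP/rowP => j; rewrite mxE.
  by apply/eqP; rewrite -normr_eq0 -sqrf_eq0 H // => l _; rewrite exprn_ge0.
pose w := (sqrtC (rownorm u 0))^-1 *: u.
have wY : w *m Y^t* = 0 by rewrite -scalemxAl uY scaler0.
have ww : w *m w^t* = 1%:M.
  apply/matrixP => i j; rewrite !ord1 mulmx_adjE !mxE eqxx /rownorm.
  under eq_bigr do rewrite mxE normrM exprMn.
  rewrite -mulr_sumr -/(rownorm u 0) normfV ger0_norm ?sqrtC_ge0 1?ltW //.
  by rewrite exprVn sqrtCK mulVf // gt_eqF.
pose Y' := \matrix_(i, j) if i == i0 then w 0 j else Y i j.
have rY' i : row i Y' = if i == i0 then w else row i Y.
  by apply/rowP => j; rewrite !mxE; case: eqP => //; rewrite mxE.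
have rE (A B : 'M[C]_(n, m)) i j :
    (A *m B^t*) i j = (row i A *m (row j B)^t*) 0 0.
  by rewrite !mxE; apply: eq_bigr => l _; rewrite !mxE.
have rw j : w *m (row j Y)^t* = 0.
  apply/matrixP => a b; rewrite !ord1 [RHS]mxE.
  have /matrixP/(_ 0 j) := wY; rewrite [X in _ = X]mxE => <-.
  by rewrite !mxE; apply: eq_bigr => l _; rewrite !mxE.
have rw' j : row j Y *m w^t* = 0.
  by rewrite -[LHS]trmxCK adjmxM trmxCK rw trmx0 map_mx0.
have [||Q QU QY] := IH Y' (Z :\ i0).
- by rewrite (cardsD1 i0 Z) i0Z in Zk.
- move=> i j; rewrite rE !rY'.
  have [->|ni] := eqVneq i i0.
    have [_|nj] := eqVneq j i0; first by rewrite ww !mxE eqxx setD11.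
    by rewrite /= rw mxE.
  have [ej|nj] := eqVneq j i0; first by rewrite /= rw' mxE ej (negPf ni).
  by rewrite -rE YY !inE ni.
exists Q => // i niZ; rewrite QY ?inE ?(negPf niZ) ?andbF // rY'.
by case: eqP niZ => // ->; rewrite i0Z.
Qed.

End Contractions.

(** * Singular value decompositions *)

Section SVD.
Variable C : numClosedFieldType.

Lemma unitarymx_mulVmx n (T : 'M[C]_n) : T \is unitarymx -> T^t* *m T = 1%:M.
Proof.
by rewrite -trmxC_unitary => /unitarymxP; rewrite trmxCK.
Qed.

Lemma adj_diag_mx n (s : 'rV[C]_n) :
  (forall k, 0 <= s 0 k) -> (diag_mx s)^t* = diag_mx s.
Proof.
move=> s0; apply/matrixP => i j; rewrite adjmxE !mxE eq_sym.
by case: eqVneq => [->|_]; rewrite ?mulr0n ?rmorph0 // !mulr1n geC0_conj.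
Qed.

(** The rows of [X] are orthogonal with squared lengths [d]. Scaling the nonzero ones to length 1
    and filling in the others by [unitarymx_extend] gives [Q]. *)
Lemma row_svd n m (X : 'M[C]_(n, m)) (d : 'rV_n) : (n <= m)%N ->
  X *m X^t* = diag_mx d ->
  (forall k, 0 <= d 0 k) /\
  exists2 Q : 'M[C]_(n, m), Q \is unitarymx & X = diag_mx (map_mx sqrtC d) *m Q.
Proof.
move=> nm XX.
have dE i : d 0 i = rownorm X i by rewrite -mulmx_adjE XX !mxE eqxx mulr1n.
have d0 i : 0 <= d 0 i by rewrite dE rownorm_ge0.
split=> //.
(* The inverse of 0 is 0, so the rows with [d 0 i = 0] are sent to 0. *)
pose Y := diag_mx (map_mx (fun x => (sqrtC x)^-1) d) *m X.
have [||Q QU QY] := @unitarymx_extend _ n m Y [set i | d 0 i == 0] => //.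
  move=> i j; rewrite adjmxM adj_diag_mx; last first.
    by move=> k; rewrite !mxE invr_ge0 sqrtC_ge0.
  rewrite mulmxA -(mulmxA _ X) XX mul_mx_diag mul_mx_diag !mxE inE.
  case: eqVneq => [->|ne] /=; last by rewrite mulr0n !mul0r.
  have [->|dj] := eqVneq; first by rewrite sqrtC0 invr0 !mulr0.
  rewrite !mulr1n /=.
  by rewrite -[X in _ * X / _]sqrtCK expr2 !mulrA mulVf ?mul1r ?divff // sqrtC_eq0.
exists Q => //; apply/matrixP => i j; rewrite mul_diag_mx !mxE.
have [di|di] := eqVneq (d 0 i) 0.
  rewrite di sqrtC0 mul0r; have := dE i; rewrite di => /esym/psumr_eq0P H.
  by apply/eqP; rewrite -normr_eq0 -sqrf_eq0 H // => l _; rewrite exprn_ge0.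
have niZ : i \notin [set i | d 0 i == 0] by rewrite inE.
have /matrixP/(_ 0 j) := QY i niZ; rewrite mxE => ->.
rewrite mxE /Y mul_diag_mx !mxE.
by rewrite mulVKf // sqrtC_eq0.
Qed.

Lemma gram_spectral n m (X : 'M[C]_(n, m)) (T := spectralmx (X *m X^t*)) :
  X *m X^t* = T^t* *m diag_mx (spectral_diag (X *m X^t*)) *m T.
Proof.
rewrite -invmx_unitary ?spectral_unitarymx //; apply/orthomx_spectralP.
by apply/normalmxP; rewrite !adjmxM trmxCK.
Qed.

Lemma spectral_gram_diag n m (X : 'M[C]_(n, m)) (T := spectralmx (X *m X^t*)) :
  (T *m X) *m (T *m X)^t* = diag_mx (spectral_diag (X *m X^t*)).
Proof.
rewrite adjmxM -mulmxA (mulmxA X) [X in _ *m (X *m _)]gram_spectral -/T.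
have TT : T *m T^t* = 1%:M by apply/unitarymxP/spectral_unitarymx.
by rewrite -(mulmxA _ T) TT mulmx1 mulmxA TT mul1mx.
Qed.

(** Starting from the adjoint makes [d] the spectrum of [A^t* *m A], the one that defines singular
    values. *)
Lemma square_svd n (A : 'M[C]_n) (d := spectral_diag (A^t* *m A)) :
  (forall k, 0 <= d 0 k) /\
  exists U V : 'M[C]_n, [/\ U \is unitarymx, V \is unitarymx &
    A = U *m diag_mx (map_mx sqrtC d) *m V].
Proof.
have := spectral_gram_diag (A^t*); rewrite trmxCK -/d; set T := spectralmx _.
move=> /(row_svd (leqnn n))[d0 [Q QU TQ]]; split=> //.
exists (Q^t*), T; split; rewrite ?trmxC_unitary ?spectral_unitarymx //.
rewrite -[diag_mx _]adj_diag_mx => [|k]; last by rewrite mxE sqrtC_ge0.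
rewrite -adjmxM -TQ adjmxM trmxCK -mulmxA unitarymx_mulVmx ?mulmx1 //.
exact: spectral_unitarymx.
Qed.

(** The thin decomposition; the witness [r] is the smaller of [n] and [m]. The last clause makes the
    polar part [A *m B] a partial unitary. *)
Lemma rect_svd n m (X : 'M[C]_(n, m)) :
  exists r (A : 'M[C]_(n, r)) (s : 'rV_r) (B : 'M[C]_(r, m)),
    [/\ X = A *m diag_mx s *m B, forall k, 0 <= s 0 k,
        A^t* \is unitarymx, B \is unitarymx &
        ((n <= m)%N -> A *m B \is unitarymx) /\
        ((m <= n)%N -> (A *m B)^t* \is unitarymx)].
Proof.
wlog nm : n m X / (n <= m)%N => [W|].
  case/orP: (leq_total n m) => [|mn]; first exact: W.
  have [r [A [s [B [XE s0 AU BU [AB1 AB2]]]]]] := W _ _ (X^t*) mn.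
  exists r, (B^t*), s, (A^t*); rewrite trmxCK; split=> //.
    by rewrite -[LHS]trmxCK XE !adjmxM adj_diag_mx // mulmxA.
  by rewrite -adjmxM trmxCK.
have := spectral_gram_diag X; set T := spectralmx _.
move=> /(row_svd nm)[d0 [Q QU TQ]].
have TU : T \is unitarymx by exact: spectral_unitarymx.
exists n, (T^t*), (map_mx sqrtC (spectral_diag (X *m X^t*))), Q; split=> //.
- by rewrite -mulmxA -TQ mulmxA unitarymx_mulVmx ?mul1mx.
- by move=> k; rewrite mxE sqrtC_ge0.
- by rewrite trmxCK.
have TQU : T^t* *m Q \is unitarymx by rewrite mul_unitarymx ?trmxC_unitary.
(* Here [n = m], and orthonormal rows amount to orthonormal columns. *)
split=> // mn; have e : n = m by apply/eqP; rewrite eqn_leq nm.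
by move: TQU; case: _ / e (_ *m _) => M; rewrite trmxC_unitary.
Qed.

End SVD.

(** * Convexity of powers *)

Section PowerMeans.
Variables (R : realType) (p : R).
Hypothesis p_ge1 : 1 <= p.

Lemma powR_le_base (r x y : R) : 0 <= r -> 0 <= x -> x <= y -> x `^ r <= y `^ r.
Proof.
by move=> r0 x0 xy; apply: ge0_ler_powR; rewrite ?nnegrE // (le_trans x0).
Qed.

Lemma invr_powR (r x : R) : 0 <= x -> x^-1 `^ r = (x `^ r)^-1.
Proof. by move=> x0; rewrite -powR_inv1 // powRAC powR_inv1 // powR_ge0. Qed.

(** The graph of x^p lies above its tangent at [t]. This is Young's inequality for s and t^(p-1)
    with exponents p and p/(p-1), the case p = 1 being separate. *)
Lemma powR_tangent (s t : R) : 0 <= s -> 0 <= t ->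
  p * (s * t `^ (p - 1)) <= s `^ p + (p - 1) * t `^ p.
Proof.
move=> s0 t0; have p0 : 0 < p by apply: lt_le_trans p_ge1.
have [p1|] := eqVneq p 1.
  by rewrite p1 subrr powRr0 mul0r addr0 powRr1 // mul1r mulr1.
move=> pN1; have p1 : 0 < p - 1 by rewrite subr_gt0 lt_neqAle eq_sym pN1.
have q0 : 0 < p / (p - 1) by rewrite divr_gt0.
have := @conjugate_powR _ s (t `^ (p - 1)) p (p / (p - 1)) s0 (powR_ge0 _ _) p0 q0.
rewrite -powRrM mulrCA divff ?gt_eqF // mulr1 invf_div => /(_ _)/wrap[|H].
  by field; rewrite gt_eqF.
rewrite -(ler_pM2l p0) in H; apply: le_trans H _.
rewrite le_eqVlt; apply/orP; left; apply/eqP; field.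
by rewrite gt_eqF.
Qed.

(** Average the tangent inequality at the weighted mean [t]. Total weight below 1 is harmless
    because the constant term (p-1) t^p is nonnegative. *)
Lemma powR_jensen (K : finType) (c s : K -> R) :
  (forall k, 0 <= c k) -> (forall k, 0 <= s k) -> \sum_k c k <= 1 ->
  (\sum_k c k * s k) `^ p <= \sum_k c k * s k `^ p.
Proof.
move=> c0 s0 c1; set t := \sum_k c k * s k.
have t0 : 0 <= t by apply: sumr_ge0 => k _; rewrite mulr_ge0.
have p0 : 0 < p by apply: lt_le_trans p_ge1.
have : \sum_k c k * (p * (s k * t `^ (p - 1)))
    <= \sum_k c k * (s k `^ p + (p - 1) * t `^ p).
  by apply: ler_sum => k _; rewrite ler_wpM2l // powR_tangent.
under eq_bigr do rewrite mulrCA.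
rewrite -mulr_sumr.
under eq_bigr do rewrite mulrA.
rewrite -mulr_suml -/t mulr_powRB1 //.
under [X in _ <= X]eq_bigr do rewrite mulrDr.
rewrite big_split /= -mulr_suml.
have : (\sum_k c k) * ((p - 1) * t `^ p) <= (p - 1) * t `^ p.
  by rewrite ler_piMl // mulr_ge0 ?powR_ge0 // subr_ge0.
lra.
Qed.

(** Jensen along each row, then the column sums. *)
Lemma powR_substochastic (I K : finType) (c : I -> K -> R) (s : K -> R) :
  (forall i k, 0 <= c i k) -> (forall k, 0 <= s k) ->
  (forall i, \sum_k c i k <= 1) -> (forall k, \sum_i c i k <= 1) ->
  \sum_i (\sum_k c i k * s k) `^ p <= \sum_k s k `^ p.
Proof.
move=> c0 s0 rs cs.
apply: (@le_trans _ _ (\sum_i \sum_k c i k * s k `^ p)).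
  by apply: ler_sum => i _; exact: powR_jensen.
rewrite exchange_big; apply: ler_sum => k _.
by rewrite -mulr_suml ler_piMl // powR_ge0.
Qed.

(** Minkowski's inequality without roots: (a+b)/(x+y) is the average of a/x and b/y with weights
    x/(x+y) and y/(x+y), so convexity applies. *)
Lemma powR_minkowski (I : finType) (a b : I -> R) (x y N : R) :
  (forall i, 0 <= a i) -> (forall i, 0 <= b i) -> 0 < x -> 0 < y ->
  \sum_i a i `^ p <= N * x `^ p -> \sum_i b i `^ p <= N * y `^ p ->
  \sum_i (a i + b i) `^ p <= N * (x + y) `^ p.
Proof.
move=> a0 b0 x0 y0 aN bN; have xy0 : 0 < x + y by rewrite addr_gt0.
have xp : 0 < x `^ p by rewrite powR_gt0.
have yp : 0 < y `^ p by rewrite powR_gt0.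
have xyp : 0 < (x + y) `^ p by rewrite powR_gt0.
have key i : (a i + b i) `^ p <= (x + y) `^ p *
     (x / (x + y) * (a i `^ p / x `^ p) + y / (x + y) * (b i `^ p / y `^ p)).
  rewrite -ler_pdivrMl //.
  have := @powR_jensen bool (fun z => if z then x / (x + y) else y / (x + y))
    (fun z => if z then a i / x else b i / y).
  rewrite !big_bool /= => H.
  have -> : ((x + y) `^ p)^-1 * (a i + b i) `^ p = ((a i + b i) / (x + y)) `^ p.
    by rewrite powRM ?addr_ge0 ?invr_ge0 ?(ltW xy0) // invr_powR ?(ltW xy0) // mulrC.
  have -> : (a i + b i) / (x + y)
      = x / (x + y) * (a i / x) + y / (x + y) * (b i / y).
    by field; rewrite !gt_eqF.
  apply: le_trans (H _ _ _) _.
  - by case; rewrite divr_ge0 // ltW.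
  - by case; rewrite divr_ge0 // ltW.
  - by rewrite -mulrDl divff // gt_eqF.
  by rewrite !powRM ?invr_ge0 ?(ltW x0) ?(ltW y0) // !invr_powR ?(ltW x0) ?(ltW y0).
apply: le_trans (ler_sum _ (fun i _ => key i)) _.
rewrite -mulr_sumr mulrC ler_pM2r // big_split /= -!mulr_sumr -!mulr_suml.
have Ha : (\sum_i a i `^ p) / x `^ p <= N by rewrite ler_pdivrMr.
have Hb : (\sum_i b i `^ p) / y `^ p <= N by rewrite ler_pdivrMr.
apply: (@le_trans _ _ (x / (x + y) * N + y / (x + y) * N)).
  by rewrite lerD // ler_wpM2l // divr_ge0 // ltW.
by rewrite -!mulrDl divff ?mul1r // gt_eqF.
Qed.

End PowerMeans.

(** * Schatten norms *)

Section ContractionRows.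
Variable C : numClosedFieldType.

Lemma rownorm_parallelogram m n (v w : 'M[C]_(m, n)) i :
  rownorm (v - w) i + rownorm (v + w) i = (rownorm v i + rownorm w i) *+ 2.
Proof.
rewrite /rownorm -!big_split /= -sumrMnl; apply: eq_bigr => j _.
by rewrite !mxE !normCK rmorphD rmorphN; ring.
Qed.

Lemma contraction_rownorm m n (A : 'M[C]_(m, n)) i :
  contraction A -> rownorm A i <= 1.
Proof.
move=> /(_ _ 1%:M i); rewrite mul1mx -(mulmx_adjE 1%:M).
by rewrite adjmx1 mulmx1 mxE eqxx.
Qed.

End ContractionRows.

(** * Singular values as extremal diagonal entries *)

Section SingularValues.
Variables (R : realType) (C : numClosedFieldType).
Variables (toC : {rmorphism R -> C}) (cabs : C -> R).
Hypothesis toC_le : forall x y, (toC x <= toC y) = (x <= y).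
Hypothesis cabsE : forall z, toC (cabs z) = `|z|.
Local Notation "x %:C" := (toC x) : ring_scope.

(* [C] and [cabs] stand for [R[i]] and the real-valued modulus; [sv] and [nsch] then are
   [singular_value] and [nschatten]. *)
Definition sv (n : nat) (A : 'M[C]_n) (i : 'I_n) : R :=
  Num.sqrt (cabs (spectral_diag (A^t* *m A) 0 i)).

Definition nsch (p : R) (n : nat) (A : 'M[C]_n) : R :=
  (n%:R^-1 * \sum_(i < n) sv A i `^ p) `^ p^-1.

Lemma toC_ge0 x : (0 <= x%:C) = (0 <= x).
Proof. by rewrite -(rmorph0 toC) toC_le. Qed.

Lemma cabs_ge0 z : 0 <= cabs z.
Proof. by rewrite -toC_ge0 cabsE normr_ge0. Qed.

Lemma cabs_le z (x : R) : `|z| <= x%:C -> cabs z <= x.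
Proof. by rewrite -toC_le cabsE. Qed.

Lemma cabs_real (x : R) : 0 <= x -> cabs x%:C = x.
Proof.
by move=> x0; apply: (fmorph_inj toC); rewrite cabsE ger0_norm ?toC_ge0.
Qed.

(** By the inequality of means it dominates |A_ik| |B_ki|, and for contractions it is doubly
    substochastic. *)
Definition crossweight n r (A : 'M[C]_(n, r)) (B : 'M[C]_(r, n)) i k : R :=
  2^-1 * (cabs (A i k) ^+ 2 + cabs (B k i) ^+ 2).

Lemma crossweight_ge0 n r (A : 'M[C]_(n, r)) (B : 'M[C]_(r, n)) i k :
  0 <= crossweight A B i k.
Proof. by rewrite mulr_ge0 ?addr_ge0 ?exprn_ge0 ?cabs_ge0 ?invr_ge0. Qed.

Lemma sum_cabs_row m n (A : 'M[C]_(m, n)) i :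
  (\sum_k cabs (A i k) ^+ 2)%:C = rownorm A i.
Proof. by rewrite rmorph_sum; apply: eq_bigr => k _; rewrite rmorphXn /= cabsE. Qed.

Lemma sum_cabs_col m n (A : 'M[C]_(m, n)) k :
  (\sum_i cabs (A i k) ^+ 2)%:C = rownorm (A^t*) k.
Proof.
rewrite rownorm_adj rmorph_sum; apply: eq_bigr => i _.
by rewrite rmorphXn /= cabsE.
Qed.

Lemma contraction_row_le1 m n (A : 'M[C]_(m, n)) i :
  contraction A -> \sum_k cabs (A i k) ^+ 2 <= 1.
Proof.
move=> cA; have := contraction_rownorm i cA.
by rewrite -(sum_cabs_row A) -(rmorph1 toC) toC_le.
Qed.

Lemma contraction_col_le1 m n (A : 'M[C]_(m, n)) k :
  contraction A -> \sum_i cabs (A i k) ^+ 2 <= 1.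
Proof.
move=> /contraction_adj cA; have := contraction_rownorm k cA.
by rewrite -(sum_cabs_col A) -(rmorph1 toC) toC_le.
Qed.

Lemma crossweight_row n r (A : 'M[C]_(n, r)) (B : 'M[C]_(r, n)) i :
  contraction A -> contraction B -> \sum_k crossweight A B i k <= 1.
Proof.
move=> /(contraction_row_le1 i) HA /(contraction_col_le1 i) HB.
by rewrite -mulr_sumr big_split /=; lra.
Qed.

Lemma crossweight_col n r (A : 'M[C]_(n, r)) (B : 'M[C]_(r, n)) k :
  contraction A -> contraction B -> \sum_i crossweight A B i k <= 1.
Proof.
move=> /(contraction_col_le1 k) HA /(contraction_row_le1 k) HB.
by rewrite -mulr_sumr big_split /=; lra.
Qed.

Lemma cabs_diag_mul n r (A : 'M[C]_(n, r)) (t : 'rV_r) (B : 'M[C]_(r, n)) i :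
  cabs ((A *m diag_mx t *m B) i i)
    <= \sum_k crossweight A B i k * cabs (t 0 k).
Proof.
apply: cabs_le; rewrite mul_mx_diag mxE; apply: le_trans (ler_norm_sum _ _ _) _.
rewrite rmorph_sum; apply: ler_sum => k _; rewrite mxE !normrM -!cabsE.
rewrite -!rmorphM toC_le mulrAC ler_wpM2r ?cabs_ge0 // /crossweight.
have := sqr_ge0 (cabs (A i k) - cabs (B k i)); rewrite sqrrB; lra.
Qed.

Lemma sv_ge0 n (X : 'M[C]_n) i : 0 <= sv X i.
Proof. exact: sqrtr_ge0. Qed.

Lemma sv_svd n (X : 'M[C]_n) :
  exists U V : 'M[C]_n, [/\ U \is unitarymx, V \is unitarymx &
    X = U *m diag_mx (\row_k (sv X k)%:C) *m V].
Proof.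
have [d0 [U [V [UU VU XE]]]] := square_svd X.
exists U, V; split; [exact: UU|exact: VU|rewrite {1}XE].
congr (_ *m diag_mx _ *m _).
apply/rowP => k; rewrite !mxE /sv.
move: (spectral_diag _ _ _) (d0 k) => z z0.
apply/eqP; rewrite -(@eqrXn2 _ 2) ?sqrtC_ge0 ?toC_ge0 ?sqrtr_ge0 //.
by rewrite sqrtCK -rmorphXn /= sqr_sqrtr ?cabs_ge0 // cabsE ger0_norm.
Qed.

Lemma sum_sv_sqr n (X : 'M[C]_n) :
  (\sum_i sv X i ^+ 2)%:C = \sum_i rownorm X i.
Proof.
have [U [V [UU VU XE]]] := sv_svd X.
rewrite {2}XE; under [RHS]eq_bigr do rewrite unitarymx_rownorm //.
rewrite -sum_rownorm_adj adjmxM.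
under [RHS]eq_bigr do rewrite unitarymx_rownorm ?trmxC_unitary //.
rewrite sum_rownorm_adj rmorph_sum; apply: eq_bigr => i _.
rewrite /rownorm (bigD1 i) //= !mxE eqxx mulr1n big1 ?addr0.
  by rewrite rmorphXn /= ger0_norm // toC_ge0 sv_ge0.
by move=> j ji; rewrite !mxE eq_sym (negPf ji) mulr0n normr0 expr0n.
Qed.

(** With X = U S V, testing on the rows of U^* gives the rows of S V, whose lengths are the singular
    values. *)
Lemma sv_le n (X : 'M[C]_n) (c : R) i : 0 <= c ->
  (forall k (v : 'M[C]_(k, n)) j, rownorm (v *m X) j <= (c ^+ 2)%:C * rownorm v j) ->
  sv X i <= c.
Proof.
move=> c0 H; have [U [V [UU VU XE]]] := sv_svd X.
have := H _ (U^t*) i; rewrite {1}XE !mulmxA unitarymx_mulVmx // mul1mx.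
rewrite unitarymx_rownorm //.
have -> : rownorm (U^t*) i = 1.
  by rewrite -mulmx_adjE trmxCK unitarymx_mulVmx // mxE eqxx.
rewrite mulr1 /rownorm (bigD1 i) //= !mxE eqxx mulr1n big1 ?addr0; last first.
  by move=> j ji; rewrite !mxE eq_sym (negPf ji) mulr0n normr0 expr0n.
rewrite -cabsE cabs_real ?sv_ge0 // -rmorphXn /= toC_le.
by rewrite ler_pXn2r // ?nnegrE ?sv_ge0.
Qed.

(** The parallelogram law for [v *m W] and [v], which have equal lengths. *)
Lemma sv_unitary_sub1 n (W : 'M[C]_n) i :
  W \is unitarymx -> sv (W - 1%:M) i <= 2.
Proof.
move=> WU; apply: sv_le => // k v j.
have -> : (2 ^+ 2)%:C * rownorm v j = (rownorm (v *m W) j + rownorm v j) *+ 2.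
  by rewrite unitarymx_rownorm // rmorphXn rmorph_nat /=; ring.
rewrite mulmxBr mulmx1 -rownorm_parallelogram lerDl; exact: rownorm_ge0.
Qed.

(** Removes the root and the normalization; later estimates work with the plain power sum. *)
Lemma nsch_leP n (p e : R) (X : 'M[C]_n) : (0 < n)%N -> 0 < p -> 0 <= e ->
  (nsch p X <= e) = (\sum_i sv X i `^ p <= n%:R * e `^ p).
Proof.
move=> n0 p0 e0; have nR : 0 < (n%:R : R) by rewrite ltr0n.
have S0 : 0 <= \sum_i sv X i `^ p.
  by apply: sumr_ge0 => i _; exact: powR_ge0.
have A0 : 0 <= n%:R^-1 * \sum_i sv X i `^ p.
  by rewrite mulr_ge0 // invr_ge0 ltW.
have eK (x : R) : 0 <= x -> (x `^ p) `^ p^-1 = x.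
  by move=> x0; rewrite -powRrM divff ?gt_eqF // powRr1.
have Ke (x : R) : 0 <= x -> (x `^ p^-1) `^ p = x.
  by move=> x0; rewrite -powRrM mulVf ?gt_eqF // powRr1.
rewrite -ler_pdivrMl // /nsch; apply/idP/idP => H.
  by rewrite -(Ke _ A0); exact: powR_le_base (ltW p0) (powR_ge0 _ _) H.
rewrite -(eK _ e0); apply: powR_le_base A0 H.
by rewrite invr_ge0 ltW.
Qed.

(** With X = A S B, each diagonal entry of U X V is at most a combination of singular values with
    the weights [crossweight (U *m A) (B *m V)]. *)
Lemma diag_powR_le n (p : R) (X U V : 'M[C]_n) : 1 <= p ->
  contraction U -> contraction V ->
  \sum_i cabs ((U *m X *m V) i i) `^ p <= \sum_i sv X i `^ p.
Proof.
move=> p1 cU cV; have [A [B [AU BU XE]]] := sv_svd X.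
have cUA : contraction (U *m A).
  by apply: contractionM => //; exact: unitarymx_contraction.
have cBV : contraction (B *m V).
  by apply: contractionM => //; exact: unitarymx_contraction.
apply: le_trans (powR_substochastic p1 (c := crossweight (U *m A) (B *m V))
  (s := sv X) _ _ _ _); first last.
- by move=> k; exact: crossweight_col.
- by move=> i; exact: crossweight_row.
- by move=> k; exact: sv_ge0.
- by move=> i k; exact: crossweight_ge0.
apply: ler_sum => i _; apply: powR_le_base; rewrite ?cabs_ge0 //.
  by apply: le_trans p1.
rewrite {1}XE -!mulmxA 2!mulmxA; apply: le_trans (cabs_diag_mul _ _ _ _) _.
by apply: ler_sum => k _; rewrite mxE cabs_real ?sv_ge0.
Qed.

(** The adjoint unitary factors of the decomposition attain the bound of [diag_powR_le]. *)
Lemma sv_diag n (X : 'M[C]_n) :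
  exists U V : 'M[C]_n, [/\ U \is unitarymx, V \is unitarymx &
    forall i, sv X i = cabs ((U *m X *m V) i i)].
Proof.
have [A [B [AU BU XE]]] := sv_svd X.
exists (A^t*), (B^t*); split; [by rewrite trmxC_unitary..|move=> i].
rewrite {2}XE -!mulmxA (unitarymxP BU) mulmx1 mulmxA unitarymx_mulVmx // mul1mx.
by rewrite !mxE eqxx mulr1n cabs_real ?sv_ge0.
Qed.

(** Jensen for the uniform average, then [diag_powR_le] for each [X a]. On diagonals this does the
    work of convexity of the norm. *)
Lemma avg_diag_powR (I : finType) n (p e : R) (X : I -> 'M[C]_n) (U V : 'M[C]_n) :
  (0 < #|I|)%N -> (0 < n)%N -> 1 <= p -> 0 <= e ->
  contraction U -> contraction V ->
  (forall a, nsch p (X a) <= e) ->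
  \sum_i cabs ((U *m (#|I|%:R^-1 *: \sum_a X a) *m V) i i) `^ p
    <= n%:R * e `^ p.
Proof.
move=> I0 n0 p1 e0 cU cV H; have IR : 0 < (#|I|%:R : R) by rewrite ltr0n.
have p0 : 0 < p by apply: lt_le_trans p1.
pose x a i := cabs ((U *m X a *m V) i i).
have bnd i : cabs ((U *m (#|I|%:R^-1 *: \sum_a X a) *m V) i i)
    <= \sum_a #|I|%:R^-1 * x a i.
  apply: cabs_le; rewrite -scalemxAr -scalemxAl mxE mulmx_sumr mulmx_suml summxE.
  rewrite normrM normfV normr_nat -mulr_sumr rmorphM fmorphV rmorph_nat.
  rewrite ler_wpM2l ?invr_ge0 ?ler0n // rmorph_sum.
  apply: le_trans (ler_norm_sum _ _ _) _.
  by apply: ler_sum => a _; rewrite cabsE.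
apply: (@le_trans _ _ (\sum_i \sum_a #|I|%:R^-1 * x a i `^ p)).
  apply: ler_sum => i _; apply: (@le_trans _ _ ((\sum_a #|I|%:R^-1 * x a i) `^ p)).
    apply: powR_le_base; rewrite ?cabs_ge0 ?(ltW p0) //.
  apply: (powR_jensen p1); first by move=> a; rewrite invr_ge0 ler0n.
    by move=> a; exact: cabs_ge0.
  by rewrite sumr_const -[X in X <= _]mulr_natl divff // gt_eqF.
rewrite exchange_big /=; under eq_bigr do rewrite -mulr_sumr.
rewrite -mulr_sumr ler_pdivrMl //.
apply: (@le_trans _ _ (\sum_(a : I) n%:R * e `^ p)).
  apply: ler_sum => a _; apply: le_trans (diag_powR_le _ p1 cU cV) _.
  by rewrite -nsch_leP.
by rewrite sumr_const -[X in X <= _]mulr_natl.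
Qed.

End SingularValues.

(** * Convolution operators *)

Section Convolution.
Variables (C : numClosedFieldType) (G : finGroupType) (n N : nat).
(* [io x] plays the role of the inclusion of [C^n] at [x] into [l^2(G) (x) C^n]; it is kept
   abstract so that a change of orthonormal basis can make [conv^t* *m conv] diagonal. *)
Variables (io : G -> 'M[C]_(N, n)) (f : G -> 'M[C]_n).
Hypothesis io_orth : forall x y, (io x)^t* *m io y = (x == y)%:R%:M.
Hypothesis io_total : \sum_x io x *m (io x)^t* = 1%:M.
Hypothesis f_unitary : forall x, f x \is unitarymx.

Local Notation g := (#|G|%:R : C).

(** The left regular representation tensored with the identity of C^n, in the coordinates of
    [io]. *)
Definition trans (x : G) : 'M[C]_N := \sum_y io (x * y)%g *m (io y)^t*.

(** The operator F of the header. *)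
Definition conv : 'M[C]_N :=
  g^-1 *: \sum_x \sum_y io x *m f (x^-1 * y)%g *m (io y)^t*.

Lemma g_neq0 : g != 0.
Proof. by rewrite pnatr_eq0 -lt0n; apply/card_gt0P; exists 1%g. Qed.

Lemma conj_gV : (g^-1)^* = g^-1.
Proof. by rewrite geC0_conj // invr_ge0 ler0n. Qed.

Lemma io_ext m (A B : 'M[C]_(m, N)) :
  (forall y, A *m io y = B *m io y) -> A = B.
Proof.
move=> AB; rewrite -[A]mulmx1 -[B]mulmx1 -io_total !mulmx_sumr.
by apply: eq_bigr => y _; rewrite !mulmxA AB.
Qed.

Lemma sum_io_pick m (A : G -> 'M[C]_(m, n)) y :
  (\sum_x A x *m (io x)^t*) *m io y = A y.
Proof.
rewrite mulmx_suml (bigD1 y) //= -mulmxA io_orth eqxx mulmx1 big1 ?addr0 //.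
by move=> x /negPf xy; rewrite -mulmxA io_orth xy raddf0 mulmx0.
Qed.

Lemma trans_io x y : trans x *m io y = io (x * y)%g.
Proof. exact: sum_io_pick. Qed.

Lemma transM x y : trans (x * y)%g = trans x *m trans y.
Proof. by apply: io_ext => z; rewrite -mulmxA !trans_io mulgA. Qed.

Lemma trans1 : trans 1%g = 1%:M.
Proof. by apply: io_ext => z; rewrite trans_io mul1g mul1mx. Qed.

Lemma trans_adj x : (trans x)^t* = trans x^-1%g.
Proof.
rewrite adjmx_sum (reindex_inj (mulgI x^-1%g)) /=; apply: eq_bigr => y _.
by rewrite mulKVg adjmxM trmxCK.
Qed.

Lemma conv_io y : conv *m io y = g^-1 *: \sum_x io x *m f (x^-1 * y)%g.
Proof.
rewrite -scalemxAl mulmx_suml; congr (_ *: _); apply: eq_bigr => x _.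
exact: sum_io_pick (fun y => io x *m f (x^-1 * y)%g) y.
Qed.

Lemma conv_trans x : conv *m trans x = trans x *m conv.
Proof.
apply: io_ext => y; rewrite -!mulmxA trans_io !conv_io -scalemxAr.
congr (_ *: _); rewrite mulmx_sumr (reindex_inj (mulgI x)) /=.
by apply: eq_bigr => z _; rewrite mulmxA trans_io invMg -mulgA mulKg.
Qed.

Lemma conv_adj_trans x : conv^t* *m trans x = trans x *m conv^t*.
Proof.
by rewrite -[trans x]trmxCK trans_adj -!adjmxM conv_trans.
Qed.

Lemma io_trans x : io x = trans x *m io 1%g.
Proof. by rewrite trans_io mulg1. Qed.

Lemma io_adj_trans x : (io 1%g)^t* *m trans x = (io x^-1%g)^t*.
Proof. by rewrite (io_trans x^-1%g) adjmxM trans_adj invgK. Qed.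

(** Translations permute the copies of C^n transitively, so an invariant operator has the same
    diagonal block at each of them. *)
Lemma tr_invariant (X : 'M[C]_N) :
  (forall x, X *m trans x = trans x *m X) ->
  \tr X = g * \tr ((io 1%g)^t* *m X *m io 1%g).
Proof.
move=> XT; rewrite -[X in LHS]mulmx1 -io_total mulmx_sumr raddf_sum /=.
rewrite mulr_natl -sumr_const; apply: eq_bigr => x _.
rewrite mulmxA mxtrace_mulC mulmxA (io_trans x) adjmxM trans_adj.
congr (\tr _); rewrite -!mulmxA (mulmxA X) XT -(mulmxA (trans x)).
by rewrite (mulmxA (trans x^-1%g)) -transM mulVg trans1 mul1mx.
Qed.

Lemma conv_contraction : contraction conv.
Proof.
(* Grouping pairs by a = x^-1 y exhibits F as the average of the [U a]. Each is unitary: a right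
   translation of the copies of C^n combined with [f a]. *)
pose U a := \sum_x io x *m f a *m (io (x * a)%g)^t*.
have -> : conv = g^-1 *: \sum_a U a.
  rewrite /conv [in RHS]exchange_big; congr (_ *: _); apply: eq_bigr => x _.
  rewrite (reindex_inj (mulgI x)) /=; apply: eq_bigr => a _.
  by rewrite mulKg.
apply: contraction_avg; first by apply/card_gt0P; exists 1%g.
move=> a; apply: unitarymx_contraction; apply/unitarymxP.
apply: io_ext => y; rewrite mul1mx -mulmxA.
have -> : (U a)^t* *m io y = io (y * a)%g *m (f a)^t*.
  rewrite /U adjmx_sum.
  under eq_bigr do rewrite !adjmxM trmxCK mulmxA.
  by rewrite (sum_io_pick (fun x => io (x * a)%g *m (f a)^t*)).
rewrite /U (reindex_inj (mulIg a^-1%g)) /=.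
under eq_bigr do rewrite mulgKV.
rewrite mulmxA (sum_io_pick (fun x => io (x * a^-1)%g *m f a)) mulgK.
by rewrite -mulmxA (unitarymxP (f_unitary a)) mulmx1.
Qed.

Lemma io_conv x : (io x)^t* *m conv = g^-1 *: \sum_y f (x^-1 * y)%g *m (io y)^t*.
Proof.
rewrite -scalemxAr exchange_big mulmx_sumr; congr (_ *: _).
apply: eq_bigr => y _; rewrite mulmx_sumr (bigD1 x) //= !mulmxA io_orth eqxx.
rewrite mul1mx big1 ?addr0 // => z /negPf zx.
by rewrite !mulmxA io_orth eq_sym zx raddf0 !mul0mx.
Qed.

Lemma io_conv_io x y : (io x)^t* *m conv *m io y = g^-1 *: f (x^-1 * y)%g.
Proof. by rewrite io_conv -scalemxAl (sum_io_pick (fun y => f (x^-1 * y)%g)). Qed.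

Lemma io_conv_adj_io x y :
  (io x)^t* *m conv^t* *m io y = g^-1 *: (f (y^-1 * x)%g)^t*.
Proof.
have /(congr1 (fun M => M^t*)) := io_conv_io y x.
by rewrite !adjmxM trmxCK mulmxA (adjmxZ _ (f _)) conj_gV.
Qed.

(** The block is the average over [y] of [f y *m (f y)^t*], which is 1. *)
Lemma conv_conv_adj : g *: ((io 1%g)^t* *m (conv *m conv^t*) *m io 1%g) = 1%:M.
Proof.
rewrite mulmxA io_conv invg1 -scalemxAl -scalemxAl !mulmx_suml scalerA.
rewrite divff ?g_neq0 // scale1r.
under eq_bigr => y _.
  rewrite mul1g -mulmxA -mulmxA (mulmxA _ (conv^t*)) io_conv_adj_io invg1 mul1g.
  rewrite -scalemxAr (unitarymxP (f_unitary y)).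
over.
by rewrite sumr_const -scaler_nat scalerA divff ?g_neq0 // scale1r.
Qed.

Lemma conv_adj_conv : g *: ((io 1%g)^t* *m (conv^t* *m conv) *m io 1%g) = 1%:M.
Proof.
rewrite -mulmxA -(mulmxA _ conv) conv_io -scalemxAr -scalemxAr scalerA.
rewrite divff ?g_neq0 // scale1r !mulmx_sumr.
under eq_bigr => y _.
  rewrite mulg1 !mulmxA io_conv_adj_io mulg1.
  rewrite -scalemxAl unitarymx_mulVmx //.
over.
by rewrite sumr_const -scaler_nat scalerA divff ?g_neq0 // scale1r.
Qed.

(** The function h of the header, with [a] the pair (y, z). *)
Definition smooth (u : G) : 'M[C]_n :=
  (#|{: G * G}|%:R)^-1 *:
    \sum_(a : G * G) f (u * a.1)%g *m (f (a.2^-1 * a.1)%g)^t* *m f (a.2^-1)%g.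

Lemma smoothE u :
  g *: ((io 1%g)^t* *m trans u *m (conv *m conv^t* *m conv) *m io 1%g) = smooth u.
Proof.
rewrite io_adj_trans -!mulmxA conv_io !mulmxA io_conv invgK.
rewrite -!scalemxAl -scalemxAr !scalerA divff ?g_neq0 // mul1r.
rewrite /smooth card_prod natrM invfM -(pair_bigA _ (fun y z =>
  f (u * y)%g *m (f (z^-1 * y)%g)^t* *m f (z^-1)%g)) /=.
rewrite -scalerA; congr (_ *: _).
rewrite !mulmx_suml scaler_sumr; apply: eq_bigr => y _.
rewrite mulmx_sumr scaler_sumr; apply: eq_bigr => z _.
by rewrite mulg1 scalemxAl [in RHS]scalemxAr -io_conv_adj_io !mulmxA.
Qed.

(** By invariance only the block at the identity matters. There the last F^* spreads over all [w]
    with coefficients f(w)^* / |G|, and the first three factors yield h(w). *)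
Lemma tr_conv4 :
  \tr (conv *m conv^t* *m conv *m conv^t*)
    = g^-1 * \sum_w \tr (smooth w *m (f w)^t*).
Proof.
have K x : conv *m conv^t* *m conv *m trans x
         = trans x *m (conv *m conv^t* *m conv).
  by rewrite -mulmxA conv_trans !mulmxA -(mulmxA conv) conv_adj_trans
     !mulmxA conv_trans.
rewrite tr_invariant => [|x]; last first.
  by rewrite -mulmxA conv_adj_trans mulmxA K !mulmxA.
rewrite -mulmxA -(mulmxA _ _ (io 1%g)).
have -> : conv^t* *m io 1%g = g^-1 *: \sum_w io w *m (f w)^t*.
  rewrite -[LHS]trmxCK adjmxM trmxCK io_conv adjmxZ conj_gV adjmx_sum.
  by under eq_bigr do rewrite adjmxM trmxCK invg1 mul1g.
rewrite -scalemxAr -scalemxAr mulmxA mxtraceZ mulrA divff ?g_neq0 // mul1r.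
rewrite mulmx_sumr raddf_sum mulr_sumr /=; apply: eq_bigr => w _.
rewrite -smoothE -scalemxAl mxtraceZ mulrA mulVf ?g_neq0 // mul1r.
congr (\tr _); rewrite (io_trans w); move: (K w); move: (_ *m conv) => M MK.
by rewrite -!mulmxA; congr (_ *m _); rewrite !mulmxA MK.
Qed.

End Convolution.

(** * Orthonormal frames indexed by the group *)

Section Frames.
Variables (C : numClosedFieldType) (G : finGroupType) (n : nat).

Definition frame N (io : G -> 'M[C]_(N, n)) : Prop :=
  (forall x y, (io x)^t* *m io y = (x == y)%:R%:M) /\
  \sum_x io x *m (io x)^t* = 1%:M.

Lemma standard_frame : exists N (io : G -> 'M[C]_(N, n)), frame io.
Proof.
pose N := #|{: G * 'I_n}|.
exists N, (fun x => \matrix_(a < N, j < n) (enum_val a == (x, j))%:R); split.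
  move=> x y; apply/matrixP => i j; rewrite !mxE.
  rewrite (reindex (@enum_rank _)); last first.
    by exists enum_val => a _; rewrite ?enum_valK ?enum_rankK.
  rewrite (bigD1 (x, i)) //= big1 ?addr0 => [|a /negPf ax].
    rewrite !mxE !enum_rankK eqxx xpair_eqE conjC_nat mul1r.
    by case: eqP => _ /=; rewrite ?mulr0n ?mul0rn //; case: (i == j).
  by rewrite !mxE enum_rankK ax conjC0 mul0r.
apply/matrixP => a b; rewrite summxE.
under eq_bigr do rewrite mxE.
under eq_bigr do under eq_bigr do rewrite !mxE conjC_nat.
rewrite pair_bigA /= (bigD1 (enum_val a)) //= big1 ?addr0 => [|c ca].
  by rewrite !mxE -surjective_pairing eqxx mul1r eq_sym (inj_eq enum_val_inj).
by rewrite -surjective_pairing eq_sym (negPf ca) mul0r.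
Qed.

Lemma frame_rotate N (T : 'M[C]_N) (io : G -> 'M[C]_(N, n)) f :
  T \is unitarymx -> frame io ->
  frame (fun x => T *m io x) /\
  conv (fun x => T *m io x) f = T *m conv io f *m T^t*.
Proof.
move=> TU [orth tot]; split; first split.
- move=> x y; rewrite adjmxM -mulmxA (mulmxA (T^t*)) unitarymx_mulVmx //.
  by rewrite mul1mx orth.
- under eq_bigr do rewrite adjmxM mulmxA -(mulmxA T).
  by rewrite -mulmx_suml -mulmx_sumr tot mulmx1 (unitarymxP TU).
rewrite /conv -scalemxAr -scalemxAl mulmx_sumr mulmx_suml; congr (_ *: _).
apply: eq_bigr => x _; rewrite mulmx_sumr mulmx_suml; apply: eq_bigr => y _.
by rewrite adjmxM !mulmxA.
Qed.

(** A standard frame is rotated to the eigenbasis of F^* F, so that functions of this operator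
    become entrywise. *)
Lemma diagonal_frame f :
  exists N (io : G -> 'M[C]_(N, n)) (d : 'rV_N),
    frame io /\ (conv io f)^t* *m conv io f = diag_mx d.
Proof.
have [N [io fr]] := standard_frame; set F := conv io f.
have := spectral_gram_diag (F^t*); set T := spectralmx _ => TF.
have TU : T \is unitarymx by exact: spectral_unitarymx.
have [fr' FE] := frame_rotate f TU fr.
exists N, (fun x => T *m io x), (spectral_diag ((F^t*) *m (F^t*)^t*)); split=> //.
rewrite FE !adjmxM trmxCK -!mulmxA (mulmxA (T^t*) T) unitarymx_mulVmx // mul1mx.
by move: TF => /= TF; rewrite -TF adjmxM !trmxCK -!mulmxA.
Qed.

End Frames.

(** * Diagonal entries *)

Section Small.
Variables (R : realType) (C : numClosedFieldType).
Variables (toC : {rmorphism R -> C}) (cabs : C -> R).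
Hypothesis toC_le : forall x y, (toC x <= toC y) = (x <= y).
Hypothesis cabsE : forall z, toC (cabs z) = `|z|.
Local Notation "x %:C" := (toC x) : ring_scope.

Lemma conj_toC x : (x%:C)^* = x%:C.
Proof.
apply/CrealP; rewrite realE (toC_ge0 toC_le) -(rmorph0 toC) toC_le.
by rewrite -realE num_real.
Qed.

Lemma norm_toC x : `|x%:C| = `|x|%:C.
Proof.
have [x0|x0] := leP 0 x; first by rewrite !ger0_norm ?(toC_ge0 toC_le).
by rewrite (ltr0_norm x0) rmorphN /= ler0_norm // -(rmorph0 toC) toC_le ltW.
Qed.

Lemma cabsD x y : cabs (x + y) <= cabs x + cabs y.
Proof. by rewrite -toC_le rmorphD /= !cabsE ler_normD. Qed.

(** What operator norm at most 1 and trace norm at most [K] imply for the diagonal. *)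
Definition diag_small n (K : R) (M : 'M[C]_n) : Prop :=
  (forall i, cabs (M i i) <= 1) /\ \sum_i cabs (M i i) <= K.

Lemma diag_small_factor n r K (A : 'M[C]_(n, r)) (t : 'rV_r) (B : 'M[C]_(r, n)) :
  contraction A -> contraction B ->
  (forall k, cabs (t 0 k) <= 1) -> \sum_k cabs (t 0 k) <= K ->
  diag_small K (A *m diag_mx t *m B).
Proof.
move=> cA cB t1 tK; have t0 k : 0 <= cabs (t 0 k) := cabs_ge0 toC_le cabsE _.
have w0 i k := crossweight_ge0 toC_le cabsE A B i k.
split=> [i|].
  apply: le_trans (cabs_diag_mul toC_le cabsE _ _ _ _) _.
  apply: le_trans (crossweight_row toC_le cabsE i cA cB).
  by apply: ler_sum => k _; rewrite ler_piMr.
apply: le_trans (ler_sum _ (fun i _ => cabs_diag_mul toC_le cabsE _ _ _ i)) _.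
apply: le_trans tK; rewrite exchange_big; apply: ler_sum => k _ /=.
by rewrite -mulr_suml ler_piMl // (crossweight_col toC_le cabsE).
Qed.

(** The first hypothesis bounds X X^* - 1 by Z Z^* as a quadratic form. If X = A S B, the polar part
    V = A B satisfies X - V = A (S - 1) B, and the form is tested on the columns of A. *)
Lemma polar_approx n m N (X : 'M[C]_(n, m)) (Z : 'M[C]_(n, N)) (K : R) :
  (forall r (Y : 'M[C]_(r, n)) k,
     `|(Y *m (X *m X^t* - 1%:M) *m Y^t*) k k| <= rownorm (Y *m Z) k) ->
  contraction Z -> \sum_i rownorm Z i <= K%:C ->
  exists V : 'M[C]_(n, m),
    [/\ (n <= m)%N -> V \is unitarymx, (m <= n)%N -> V^t* \is unitarymx,
        contraction V &
        exists r (A : 'M[C]_(n, r)) (t : 'rV_r) (B : 'M[C]_(r, m)),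
          [/\ X - V = A *m diag_mx t *m B, contraction A, contraction B,
              forall k, cabs (t 0 k) <= 1 & \sum_k cabs (t 0 k) <= K]].
Proof.
move=> HZ cZ ZK; have [r [A [s [B [XE s0 AU BU [V1 V2]]]]]] := rect_svd X.
have cA : contraction A.
  by rewrite -[A]trmxCK; apply/contraction_adj/unitarymx_contraction.
have cB : contraction B by exact: unitarymx_contraction.
pose t := s - const_mx 1.
have tE k : `|t 0 k| <= rownorm (A^t* *m Z) k.
  apply: le_trans (HZ _ _ _); rewrite trmxCK mulmxBr mulmxBl mulmx1.
  have -> : A^t* *m A = 1%:M by have /unitarymxP := AU; rewrite trmxCK.
  have -> : A^t* *m (X *m X^t*) *m A = diag_mx s *m diag_mx s.
    have E : A^t* *m X = diag_mx s *m B.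
      rewrite XE !mulmxA; have /unitarymxP := AU; rewrite trmxCK => ->.
      by rewrite mul1mx.
    rewrite mulmxA E -mulmxA -[A in X in _ *m X]trmxCK -adjmxM E adjmxM.
    by rewrite adj_diag_mx // mulmxA -(mulmxA _ B) (unitarymxP BU) mulmx1.
  rewrite mul_mx_diag !mxE eqxx mulr1n.
  (* As s + 1 >= 1, the factorization gives |s - 1| <= |s^2 - 1|. *)
  have -> : s 0 k * s 0 k - 1 = (s 0 k - 1) * (s 0 k + 1) by ring.
  rewrite normrM ler_peMr // ger0_norm ?addr_ge0 //.
  by rewrite lerDr.
exists (A *m B); split => //; first exact: contractionM.
exists r, A, t, B; split=> //.
- rewrite {1}XE /t raddfB /= mulmxBr mulmxBl; congr (_ - _ *m _).
  by rewrite diag_const_mx mulmx1.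
- move=> k; rewrite -toC_le cabsE rmorph1; apply: le_trans (tE k) _.
  by apply/contraction_rownorm/contractionM => //; exact: contraction_adj.
rewrite -toC_le rmorph_sum /=; apply: le_trans ZK.
under eq_bigr do rewrite cabsE.
apply: le_trans (ler_sum _ (fun k _ => tE k)) _.
rewrite -(sum_rownorm_adj (A^t* *m Z)) -(sum_rownorm_adj Z) adjmxM trmxCK.
by apply: ler_sum => i _; exact: cA.
Qed.

(** Splitting |w| as l r, each diagonal entry is at most half the sum of the squared row lengths of
    X l and Y^* r. Contractivity bounds the entries, Hilbert-Schmidt norms their sum. *)
Lemma diag_small_cross n N K (l r w : 'I_N -> R) (X : 'M[C]_(n, N)) (Y : 'M[C]_(N, n)) :
  (forall j, 0 <= l j) -> (forall j, 0 <= r j) -> (forall j, `|w j| = l j * r j) ->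
  contraction (X *m diag_mx (\row_j (l j)%:C)) ->
  contraction (Y^t* *m diag_mx (\row_j (r j)%:C)) ->
  \sum_i rownorm (X *m diag_mx (\row_j (l j)%:C)) i <= K%:C ->
  \sum_i rownorm (Y^t* *m diag_mx (\row_j (r j)%:C)) i <= K%:C ->
  diag_small K (X *m diag_mx (\row_j (w j)%:C) *m Y).
Proof.
move=> l0 r0 wE cX cY.
set P := X *m _ in cX *; set Q := Y^t* *m _ in cY * => PK QK.
pose rn (M : 'M[C]_(n, N)) i := \sum_j cabs (M i j) ^+ 2.
have bnd i : cabs ((X *m diag_mx (\row_j (w j)%:C) *m Y) i i)
    <= 2^-1 * (rn P i + rn Q i).
  rewrite /rn -big_split mulr_sumr; apply: (cabs_le toC_le cabsE).
  rewrite mul_mx_diag mxE; apply: le_trans (ler_norm_sum _ _ _) _.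
  rewrite rmorph_sum; apply: ler_sum => j _ /=.
  have -> : cabs (P i j) = cabs (X i j) * l j.
    apply: (fmorph_inj toC); rewrite /P mul_mx_diag !mxE rmorphM /= !cabsE normrM.
    by rewrite [X in _ * X]ger0_norm ?(toC_ge0 toC_le).
  have -> : cabs (Q i j) = cabs (Y j i) * r j.
    apply: (fmorph_inj toC); rewrite /Q mul_mx_diag !mxE rmorphM /= !cabsE normrM.
    by rewrite norm_conjC [X in _ * X]ger0_norm ?(toC_ge0 toC_le).
  rewrite !mxE !normrM -!cabsE -!rmorphM toC_le.
  have -> : cabs (w j)%:C = l j * r j.
    by rewrite -wE; apply: (fmorph_inj toC); rewrite cabsE norm_toC.
  have := sqr_ge0 (cabs (X i j) * l j - cabs (Y j i) * r j); rewrite sqrrB.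
  by lra.
split=> [i|].
  apply: le_trans (bnd i) _.
  have := contraction_row_le1 toC_le cabsE i cX.
  have := contraction_row_le1 toC_le cabsE i cY.
  rewrite -/(rn Q i) -/(rn P i); lra.
apply: le_trans (ler_sum _ (fun i _ => bnd i)) _.
rewrite -mulr_sumr big_split /=.
have HP : \sum_i rn P i <= K.
  by rewrite -toC_le rmorph_sum /=; under eq_bigr do rewrite (sum_cabs_row cabsE).
have HQ : \sum_i rn Q i <= K.
  by rewrite -toC_le rmorph_sum /=; under eq_bigr do rewrite (sum_cabs_row cabsE).
lra.
Qed.

End Small.

(** * Compression to the large eigenvalues *)

Section Compression.
Variables (R : realType) (C : numClosedFieldType).
Variables (toC : {rmorphism R -> C}) (cabs : C -> R).
Hypothesis toC_le : forall x y, (toC x <= toC y) = (x <= y).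
Hypothesis cabsE : forall z, toC (cabs z) = `|z|.
Local Notation "x %:C" := (toC x) : ring_scope.
Variables (G : finGroupType) (n N : nat).
Variables (io : G -> 'M[C]_(N, n)) (f : G -> 'M[C]_n) (d : 'rV[C]_N).
Hypothesis io_orth : forall x y, (io x)^t* *m io y = (x == y)%:R%:M.
Hypothesis io_total : \sum_x io x *m (io x)^t* = 1%:M.
Hypothesis f_unitary : forall x, f x \is unitarymx.

Local Notation F := (conv io f).
Local Notation T := (trans io).
Local Notation g := (#|G|%:R : C).

Hypothesis F_diag : F^t* *m F = diag_mx d.

Let dr j : R := cabs (d 0 j).

(** Functional calculus: h(F^* F) in its eigenbasis. *)
Definition fdiag (h : R -> R) : 'M[C]_N := diag_mx (\row_j (h (dr j))%:C).

Lemma d_rownorm j : d 0 j = rownorm (F^t*) j.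
Proof. by rewrite -mulmx_adjE trmxCK F_diag mxE eqxx mulr1n. Qed.

Lemma drE j : (dr j)%:C = d 0 j.
Proof. by rewrite cabsE ger0_norm // d_rownorm rownorm_ge0. Qed.

Lemma dr_ge0 j : 0 <= dr j.
Proof. exact: cabs_ge0. Qed.

Lemma dr_le1 j : dr j <= 1.
Proof.
rewrite -toC_le drE rmorph1 d_rownorm; apply/contraction_rownorm/contraction_adj.
exact: conv_contraction.
Qed.

Lemma fdiag_id : F^t* *m F = fdiag id.
Proof.
by rewrite F_diag; congr diag_mx; apply/rowP => j; rewrite mxE drE.
Qed.

Lemma fdiag_adj h : (fdiag h)^t* = fdiag h.
Proof.
apply/matrixP => i j; rewrite adjmxE !mxE eq_sym.
by case: eqVneq => [->|_]; rewrite ?mulr0n ?conjC0 // mulr1n (conj_toC toC_le).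
Qed.

Lemma fdiag_mul h k : fdiag h *m fdiag k = fdiag (fun x => h x * k x).
Proof.
apply/matrixP => i j; rewrite mul_mx_diag !mxE.
by case: eqVneq => [->|_]; rewrite ?mulr0n ?mul0r // !mulr1n rmorphM.
Qed.

Lemma fdiag_sub h k : fdiag h - fdiag k = fdiag (fun x => h x - k x).
Proof.
apply/matrixP => i j; rewrite !mxE.
by case: eqVneq => _; rewrite ?mulr0n ?subr0 // !mulr1n rmorphB.
Qed.

Lemma fdiag_1 : fdiag (fun=> 1) = 1%:M.
Proof. by apply/matrixP => i j; rewrite !mxE rmorph1. Qed.

Lemma eq_fdiag h k : (forall j, h (dr j) = k (dr j)) -> fdiag h = fdiag k.
Proof. by move=> hk; congr diag_mx; apply/rowP => j; rewrite !mxE hk. Qed.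

(** [T x] commutes with F^* F, so its entries between distinct eigenvalues vanish; hence it commutes
    with every function of F^* F. *)
Lemma fdiag_trans h x : fdiag h *m T x = T x *m fdiag h.
Proof.
have cT : (F^t* *m F) *m T x = T x *m (F^t* *m F).
  by rewrite -mulmxA conv_trans // !mulmxA conv_adj_trans.
apply/matrixP => i j; move/matrixP/(_ i j): cT.
rewrite fdiag_id !mul_diag_mx !mul_mx_diag !mxE => /eqP.
have [->|Tij] := eqVneq (T x i j) 0; first by rewrite !mulr0 !mul0r.
rewrite [X in _ == X]mulrC (inj_eq (mulIf Tij)) (inj_eq (fmorph_inj toC)) => /eqP->.
by rewrite mulrC.
Qed.

Lemma tr_fdiag h : \tr (fdiag h) = (\sum_j h (dr j))%:C.
Proof.
by rewrite rmorph_sum; apply: eq_bigr => j _; rewrite !mxE eqxx mulr1n.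
Qed.

(* The adjoint of the operator [J] of the header. *)
Definition ev : 'M[C]_(n, N) := sqrtC g *: (io 1%g)^t*.

Lemma evE X : ev *m X *m ev^t* = g *: ((io 1%g)^t* *m X *m io 1%g).
Proof.
rewrite /ev adjmxZ trmxCK -scalemxAl -scalemxAl -scalemxAr scalerA.
by rewrite geC0_conj ?sqrtC_ge0 ?ler0n // -expr2 sqrtCK.
Qed.

Lemma tr_ev X : (forall x, X *m T x = T x *m X) ->
  \tr (ev *m X *m ev^t*) = \tr X.
Proof. by move=> XT; rewrite evE mxtraceZ (tr_invariant io_orth). Qed.

Lemma evF_unitary : ev *m F \is unitarymx.
Proof.
by apply/unitarymxP; rewrite adjmxM mulmxA -(mulmxA ev) evE conv_conv_adj.
Qed.

Lemma rownorm_fdiag k (Z : 'M[C]_(k, N)) h i :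
  rownorm (Z *m fdiag h) i = \sum_j `|Z i j| ^+ 2 * (h (dr j) ^+ 2)%:C.
Proof.
rewrite /rownorm mul_mx_diag; apply: eq_bigr => j _.
rewrite !mxE normrM exprMn; congr (_ * _).
by rewrite normCK (conj_toC toC_le) rmorphXn.
Qed.

(** Since J^* F^* F J = 1, the squared length of v is the sum of the |(v J^* )_j|^2 d_j, which is
    compared termwise. *)
Lemma contraction_evfdiag h : (forall j, h (dr j) ^+ 2 <= dr j) ->
  contraction (ev *m fdiag h).
Proof.
move=> hd k v i; rewrite mulmxA.
have -> : rownorm v i = rownorm ((v *m ev) *m fdiag Num.sqrt) i.
  rewrite -!mulmx_adjE adjmxM fdiag_adj adjmxM !mulmxA -(mulmxA _ (fdiag _) (fdiag _))
    fdiag_mul.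
  rewrite (@eq_fdiag _ id) => [|j]; last by rewrite -expr2 sqr_sqrtr ?dr_ge0.
  rewrite -2!(mulmxA v) -fdiag_id evE conv_adj_conv //.
  by rewrite mulmx1.
rewrite !rownorm_fdiag; apply: ler_sum => j _.
by rewrite ler_wpM2l ?exprn_ge0 // toC_le sqr_sqrtr ?dr_ge0.
Qed.

Lemma contraction_fdiag h : (forall j, h (dr j) ^+ 2 <= 1) -> contraction (fdiag h).
Proof.
move=> h1 k v i; rewrite rownorm_fdiag; apply: ler_sum => j _.
by rewrite ler_piMr ?exprn_ge0 // -(rmorph1 toC) toC_le.
Qed.

Lemma sum_evfdiag h : \sum_i rownorm (ev *m fdiag h) i = (\sum_j h (dr j) ^+ 2)%:C.
Proof.
rewrite -mxtrace_mulmx_adj adjmxM fdiag_adj !mulmxA -(mulmxA ev (fdiag h) (fdiag h))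
  fdiag_mul tr_ev.
  by rewrite tr_fdiag.
by move=> x; rewrite fdiag_trans.
Qed.

(** Cyclicity of the trace brings F^* next to F, whence the factor [dr j] absent from
    [sum_evfdiag]. *)
Lemma sum_evFfdiag h :
  \sum_i rownorm (ev *m F *m fdiag h) i = (\sum_j h (dr j) ^+ 2 * dr j)%:C.
Proof.
rewrite -mxtrace_mulmx_adj !adjmxM fdiag_adj !mulmxA -(mulmxA _ (fdiag h) (fdiag h))
  fdiag_mul.
rewrite -(mulmxA ev F) -(mulmxA ev _ (F^t*)) tr_ev.
  by rewrite -mulmxA mxtrace_mulC -mulmxA fdiag_id fdiag_mul tr_fdiag.
move=> x; rewrite -!mulmxA conv_adj_trans // (mulmxA (fdiag _)) fdiag_trans.
by rewrite -(mulmxA (T x)) (mulmxA F) conv_trans // !mulmxA.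
Qed.

Lemma trans_unitary x : T x \is unitarymx.
Proof.
apply/unitarymxP; rewrite trans_adj -transM // mulgV; exact: trans1.
Qed.

Lemma sum_evTFfdiag h x :
  \sum_i rownorm (ev *m T x *m F *m fdiag h) i = (\sum_j h (dr j) ^+ 2 * dr j)%:C.
Proof.
rewrite -sum_evFfdiag; apply: eq_bigr => i _.
rewrite -(unitarymx_rownorm (ev *m F *m fdiag h) i (trans_unitary x)).
congr rownorm; rewrite -!mulmxA fdiag_trans (mulmxA F) conv_trans //.
by rewrite !mulmxA.
Qed.

Lemma quad_fdiag_le m k (Z : 'M[C]_(m, N)) (Y : 'M[C]_(k, m)) h l i :
  (forall j, `|h (dr j)| <= l (dr j) ^+ 2) ->
  `|(Y *m (Z *m fdiag h *m Z^t*) *m Y^t*) i i| <= rownorm (Y *m (Z *m fdiag l)) i.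
Proof.
move=> hl; rewrite !mulmxA -(mulmxA _ (Z^t*)) -adjmxM rownorm_fdiag.
rewrite mul_mx_diag mxE; apply: le_trans (ler_norm_sum _ _ _) _.
apply: ler_sum => j _; rewrite adjmxE !mxE !normrM norm_conjC mulrAC -expr2.
by rewrite ler_wpM2l ?exprn_ge0 // (norm_toC toC_le) toC_le.
Qed.

Definition above_half (x : R) : R := (2^-1 < x)%R%:R.
(** On [0, 1], the distance from x to the nearer of 0 and 1, that is |x - [above_half x]|. *)
Definition defect (x : R) : R := if 2^-1 < x then 1 - x else x.
(** The dimension m of the theorem. *)
Definition cutdim := #|[pred j | (2^-1 < dr j)%R]|.
Definition emb : 'M[C]_(N, cutdim) := \matrix_(j, k) (j == enum_val k)%:R.
Definition total_defect : R := \sum_j defect (dr j).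

Lemma defect_ge0 j : 0 <= defect (dr j).
Proof. by rewrite /defect; case: ifP => _; rewrite ?subr_ge0 ?dr_ge0 ?dr_le1. Qed.

Lemma defect_le j : defect (dr j) <= dr j.
Proof. by rewrite /defect; case: ltP => // h; lra. Qed.

(** The larger of d and 1 - d is at least 1/2. *)
Lemma defect_quad j : defect (dr j) <= 2 * (dr j * (1 - dr j)).
Proof.
have := dr_ge0 j; have := dr_le1 j; rewrite /defect; case: ltP; nra.
Qed.

Lemma emb_adj_emb : emb^t* *m emb = 1%:M.
Proof.
apply/matrixP => a b; rewrite !mxE (bigD1 (enum_val a)) //= big1 ?addr0.
  by rewrite !mxE eqxx conjC1 mul1r (inj_eq enum_val_inj).
by move=> j /negPf ja; rewrite !mxE ja conjC0 mul0r.
Qed.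

Lemma emb_emb_adj : emb *m emb^t* = fdiag above_half.
Proof.
apply/matrixP => i j; rewrite !mxE /above_half.
have [ij|ij] := ltP 2^-1 (dr i); last first.
  rewrite rmorph0 mul0rn big1 // => k _; rewrite !mxE.
  have [ik|_] := eqVneq i (enum_val k); last by rewrite mul0r.
  by have := enum_valP k; rewrite -ik inE ltNge ij.
have iS : i \in [pred j | 2^-1 < dr j] by rewrite inE.
rewrite (bigD1 (enum_rank_in iS i)) //= !mxE enum_rankK_in // eqxx mul1r.
rewrite big1 ?addr0 => [|k ki]; last first.
  rewrite !mxE; have [ik|_] := eqVneq i (enum_val k); last by rewrite mul0r.
  by case/eqP: ki; apply: enum_val_inj; rewrite enum_rankK_in.
by rewrite conjC_nat rmorph1 eq_sym.
Qed.

Lemma emb_contraction : contraction emb.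
Proof.
rewrite -[emb]trmxCK; apply/contraction_adj/unitarymx_contraction/unitarymxP.
by rewrite trmxCK emb_adj_emb.
Qed.

Definition compress x := emb^t* *m T x *m emb.

Lemma compressM x y : compress (x * y)%g = compress x *m compress y.
Proof.
rewrite /compress (transM io_orth io_total) !mulmxA -(mulmxA _ emb) emb_emb_adj.
rewrite -(mulmxA (emb^t*) (T x) (fdiag _)) -fdiag_trans !mulmxA -emb_emb_adj !mulmxA.
by rewrite emb_adj_emb mul1mx.
Qed.

Lemma compress1 : compress 1%g = 1%:M.
Proof. by rewrite /compress (trans1 io_orth io_total) mulmx1 emb_adj_emb. Qed.

Lemma compress_adj x : (compress x)^t* = compress x^-1%g.
Proof. by rewrite /compress !adjmxM trmxCK trans_adj mulmxA. Qed.

Lemma compress_unitary x : compress x \is unitarymx.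
Proof. by apply/unitarymxP; rewrite compress_adj -compressM mulgV compress1. Qed.

Lemma compress_repr : mx_repr [set: G] compress.
Proof. by split=> [|x y _ _]; [exact: compress1 | exact: compressM]. Qed.

(** As J^* F has orthonormal rows, X X^* - 1 involves only the discarded eigenvalues d_j <= 1/2. The
    trace counts each with weight d_j, its defect. *)
Lemma polar_left : exists V : 'M[C]_(n, cutdim),
  [/\ (n <= cutdim)%N -> V \is unitarymx, (cutdim <= n)%N -> V^t* \is unitarymx,
      contraction V &
      exists r (A : 'M[C]_(n, r)) (t : 'rV_r) (B : 'M[C]_(r, cutdim)),
        [/\ ev *m F *m emb - V = A *m diag_mx t *m B, contraction A, contraction B,
            forall k, cabs (t 0 k) <= 1 & \sum_k cabs (t 0 k) <= total_defect]].
Proof.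
pose l x := Num.sqrt (1 - above_half x).
have pick1 x : 0 <= 1 - above_half x by rewrite /above_half; case: ltP; rewrite ?subrr
  ?subr0.
apply: (polar_approx toC_le cabsE (Z := ev *m F *m fdiag l)).
- move=> r Y k.
  have -> : ev *m F *m emb *m (ev *m F *m emb)^t* - 1%:M
      = ev *m F *m fdiag (fun x => above_half x - 1) *m (ev *m F)^t*.
    rewrite adjmxM !mulmxA -(mulmxA _ emb) emb_emb_adj.
    rewrite -[1%:M](unitarymxP evF_unitary) -mulmxBl; congr (_ *m _).
    by rewrite -{2}[ev *m F]mulmx1 -mulmxBr -fdiag_1 fdiag_sub.
  apply: quad_fdiag_le => j; rewrite sqr_sqrtr // -normrN opprB ger0_norm //.
- apply: contractionM; first exact/unitarymx_contraction/evF_unitary.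
  by apply: contraction_fdiag => j; rewrite sqr_sqrtr // /above_half; case: ltP => _;
    rewrite ?subrr ?subr0.
rewrite sum_evFfdiag toC_le; apply: ler_sum => j _; rewrite sqr_sqrtr //.
have := dr_le1 j; rewrite /above_half /defect; case: ltP => _ /=; lra.
Qed.

(** Writing 1 as J^* F^* F J makes X X^* - 1 a compression of [above_half] minus the identity
    function, bounded by the defect. *)
Lemma polar_right : exists U : 'M[C]_(n, cutdim),
  [/\ (n <= cutdim)%N -> U \is unitarymx, (cutdim <= n)%N -> U^t* \is unitarymx,
      contraction U &
      exists r (A : 'M[C]_(n, r)) (t : 'rV_r) (B : 'M[C]_(r, cutdim)),
        [/\ ev *m emb - U = A *m diag_mx t *m B, contraction A, contraction B,
            forall k, cabs (t 0 k) <= 1 & \sum_k cabs (t 0 k) <= total_defect]].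
Proof.
pose l x := Num.sqrt (defect x).
apply: (polar_approx toC_le cabsE (Z := ev *m fdiag l)).
- move=> r Y k.
  have -> : ev *m emb *m (ev *m emb)^t* - 1%:M
      = ev *m fdiag (fun x => above_half x - x) *m ev^t*.
    rewrite adjmxM !mulmxA -(mulmxA _ emb) emb_emb_adj.
    have <- : ev *m (F^t* *m F) *m ev^t* = 1%:M by rewrite evE conv_adj_conv.
    by rewrite fdiag_id -mulmxBl -mulmxBr fdiag_sub.
  apply: quad_fdiag_le => j; rewrite sqr_sqrtr ?defect_ge0 //.
  have := dr_ge0 j; have := dr_le1 j; rewrite /above_half /defect.
  by case: ltP => _ /= h1 h0; rewrite ?sub0r ?normrN ger0_norm // subr_ge0.
- by apply: contraction_evfdiag => j; rewrite sqr_sqrtr ?defect_ge0 // defect_le.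
rewrite sum_evfdiag toC_le; apply: ler_sum => j _.
by rewrite sqr_sqrtr ?defect_ge0.
Qed.

Lemma sum_rownorm_unitary m k (U : 'M[C]_m) (M : 'M[C]_(m, k)) :
  U \is unitarymx -> \sum_i rownorm (U *m M) i = \sum_i rownorm M i.
Proof.
move=> UU; rewrite -sum_rownorm_adj -[RHS]sum_rownorm_adj adjmxM.
by apply: eq_bigr => i _; rewrite unitarymx_rownorm // trmxC_unitary.
Qed.

Lemma core_small x (U E : 'M[C]_n) : U \is unitarymx -> E \is unitarymx ->
  diag_small cabs total_defect
    (U *m (ev *m T x *m F *m fdiag (fun y => y - above_half y) *m ev^t*) *m E).
Proof.
move=> UU EU.
(* The product l r is |y - [above_half y]|. Below 1/2 it is split unevenly: beside J^* the factor
   must satisfy r^2 <= y, while beside J^* T F the trace already supplies a factor y. *)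
pose l (y : R) : R := if 2^-1 < y then Num.sqrt (1 - y) else 1.
pose r (y : R) : R := if 2^-1 < y then Num.sqrt (1 - y) else y.
have sq j : Num.sqrt (1 - dr j) ^+ 2 = 1 - dr j.
  by rewrite sqr_sqrtr // subr_ge0 dr_le1.
have d0 := dr_ge0; have d1 := dr_le1.
have -> : U *m (ev *m T x *m F *m fdiag (fun y => y - above_half y) *m ev^t*) *m E
    = (U *m (ev *m T x *m F)) *m fdiag (fun y => y - above_half y) *m (ev^t* *m E).
  by rewrite !mulmxA.
apply: (diag_small_cross toC_le cabsE (l := l \o dr) (r := r \o dr)).
- by move=> j /=; rewrite /l; case: ifP; rewrite ?sqrtr_ge0.
- by move=> j /=; rewrite /r; case: ifP; rewrite ?sqrtr_ge0.
- move=> j /=; rewrite /l /r /above_half; case: ltP => _ /=.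
    by rewrite -expr2 sq -normrN opprB ger0_norm // subr_ge0.
  by rewrite subr0 mul1r ger0_norm.
- rewrite -[diag_mx _]/(fdiag l) -mulmxA.
  apply: contractionM; first exact: unitarymx_contraction.
  apply: contractionM.
    rewrite -mulmxA -conv_trans // mulmxA.
    by apply/unitarymx_contraction/mul_unitarymx;
      [exact: evF_unitary|exact: trans_unitary].
  apply: contraction_fdiag => j; rewrite /l; case: ifP => _; last by rewrite expr1n.
  by rewrite sq; have := d0 j; lra.
- rewrite -[diag_mx _]/(fdiag r) adjmxM trmxCK -mulmxA.
  apply: contractionM; first by apply: unitarymx_contraction; rewrite trmxC_unitary.
  apply: contraction_evfdiag => j; rewrite /r; case: ltP => h.
    by rewrite sq; lra.
  by have := d0 j; nra.
- rewrite -[diag_mx _]/(fdiag l) -mulmxA sum_rownorm_unitary // sum_evTFfdiag toC_le.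
  apply: ler_sum => j _; have := d0 j; have := d1 j; rewrite /l /defect.
  by case: ltP => h; rewrite ?sq ?expr1n ?mul1r //; nra.
rewrite -[diag_mx _]/(fdiag r) adjmxM trmxCK -mulmxA.
rewrite sum_rownorm_unitary ?trmxC_unitary // sum_evfdiag toC_le.
apply: ler_sum => j _; have := d0 j; have := d1 j; rewrite /r /defect.
by case: ltP => h; rewrite ?sq //; nra.
Qed.

(** An idempotent commuting with translations, the projection can be put on both sides of [T x]. *)
Lemma compressE x :
  ev *m T x *m F *m fdiag above_half *m ev^t*
    = ev *m F *m emb *m compress x *m (ev *m emb)^t*.
Proof.
rewrite /compress adjmxM !mulmxA.
do 2!rewrite -(mulmxA _ emb (emb^t*)) emb_emb_adj.
rewrite -(mulmxA _ (fdiag above_half) (T x)) fdiag_trans.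
rewrite !mulmxA -(mulmxA _ (fdiag above_half) (fdiag above_half)) fdiag_mul.
rewrite (@eq_fdiag (fun y => above_half y * above_half y) above_half) => [|j].
  by rewrite -(mulmxA _ F (T x)) conv_trans // !mulmxA.
by rewrite /above_half; case: ltP; rewrite ?mulr1 ?mulr0.
Qed.

Lemma smooth_ev x : smooth f x = ev *m T x *m F *m fdiag id *m ev^t*.
Proof.
have -> : ev *m T x *m F *m fdiag id *m ev^t*
    = ev *m (T x *m (F *m F^t* *m F)) *m ev^t* by rewrite -fdiag_id !mulmxA.
by rewrite evE -(smoothE f io_orth x) !mulmxA.
Qed.

Lemma compression :
  exists (U V : 'M[C]_(n, cutdim)) (P : mx_representation C [set: G] cutdim),
    [/\ ((n <= cutdim)%N -> U \is unitarymx) /\ ((cutdim <= n)%N -> U^t* \is unitarymx),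
        ((n <= cutdim)%N -> V \is unitarymx) /\ ((cutdim <= n)%N -> V^t* \is unitarymx),
        forall x, P x \is unitarymx &
        forall x (A B : 'M[C]_n), A \is unitarymx -> B \is unitarymx ->
        exists M1 M2 M3 : 'M[C]_n,
          [/\ A *m (smooth f x - V *m P x *m U^t*) *m B = M1 + M2 + M3,
              diag_small cabs total_defect M1, diag_small cabs total_defect M2 &
              diag_small cabs total_defect M3]].
Proof.
have [V [V1 V2 cV [r [A1 [t1 [B1 [E1 cA1 cB1 t1_le t1_sum]]]]]]] := polar_left.
have [U [U1 U2 cU [q [A2 [t2 [B2 [E2 cA2 cB2 t2_le t2_sum]]]]]]] := polar_right.
exists U, V, (MxRepresentation compress_repr); split=> // [x|x A B AU BU] /=.
  exact: compress_unitary.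
have cA := unitarymx_contraction AU; have cB := unitarymx_contraction BU.
have cP := unitarymx_contraction (compress_unitary x).
set X := ev *m F *m emb in E1; set Y := ev *m emb in E2.
(* Telescoping: F^* F is replaced by the projection, then [Y] by [U], then [X] by [V]. *)
exists (A *m (ev *m T x *m F *m fdiag (fun y => y - above_half y) *m ev^t*) *m B),
  (A *m (X *m compress x *m (Y - U)^t*) *m B),
  (A *m ((X - V) *m compress x *m U^t*) *m B); split.
- rewrite -!mulmxDl -!mulmxDr; congr (_ *m _ *m _).
  rewrite -(@fdiag_sub id) mulmxBr mulmxBl -smooth_ev compressE -/X -/Y.
  by rewrite adjmxB !(mulmxBl, mulmxBr) !addrA !subrK.
- exact: core_small.
- rewrite E2 !adjmxM.
  have -> : (diag_mx t2)^t* = diag_mx (map_mx Num.conj t2).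
    by rewrite tr_diag_mx map_diag_mx.
  have cabsJ k : cabs ((map_mx Num.conj t2) 0 k) = cabs (t2 0 k).
    by apply: (fmorph_inj toC); rewrite !cabsE mxE norm_conjC.
  have -> : A *m
    (X *m compress x *m (B2^t* *m (diag_mx (map_mx Num.conj t2) *m A2^t*))) *m B
    = (A *m (X *m compress x *m B2^t*)) *m diag_mx (map_mx Num.conj t2) *m (A2^t* *m B).
    by rewrite !mulmxA.
  apply: (diag_small_factor toC_le cabsE).
  + apply: contractionM => //; apply: contractionM; last exact: contraction_adj.
    apply: contractionM => //; apply: contractionM; last exact: emb_contraction.
    exact/unitarymx_contraction/evF_unitary.
  + by apply: contractionM => //; exact: contraction_adj.
  + by move=> k; rewrite cabsJ.
  by under eq_bigr do rewrite cabsJ.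
rewrite E1.
have -> : A *m (A1 *m diag_mx t1 *m B1 *m compress x *m U^t*) *m B
  = (A *m A1) *m diag_mx t1 *m (B1 *m compress x *m U^t* *m B).
  by rewrite !mulmxA.
apply: (diag_small_factor toC_le cabsE) => //; first exact: contractionM.
apply: contractionM => //; apply: contractionM; last exact: contraction_adj.
exact: contractionM.
Qed.

(** The difference at each eigenvalue is its defect. With [sum_dr] this compares m with n. *)
Lemma card_dim : `|cutdim%:R - \sum_j dr j| <= total_defect.
Proof.
have -> : cutdim%:R = \sum_j above_half (dr j) :> R.
  rewrite /cutdim -sum1_card natr_sum big_mkcond /=; apply: eq_bigr => j _.
  by rewrite inE /above_half; case: ltP.
rewrite -sumrB; apply: le_trans (ler_norm_sum _ _ _) _.
apply: ler_sum => j _; have := dr_ge0 j; have := dr_le1 j.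
rewrite /above_half /defect; case: ltP => _ h1 h0; first by rewrite ger0_norm //
  subr_ge0.
by rewrite sub0r normrN ger0_norm.
Qed.

Lemma sum_dr : \sum_j dr j = n%:R.
Proof.
apply: (fmorph_inj toC); rewrite -(tr_fdiag id) -fdiag_id -tr_ev.
  by rewrite evE conv_adj_conv // mxtrace1 rmorph_nat.
by move=> x; rewrite fdiag_id fdiag_trans.
Qed.

Lemma sum_dr_sqr :
  (\sum_j dr j ^+ 2)%:C = g^-1 * \sum_w \tr (smooth f w *m (f w)^t*).
Proof.
rewrite -(tr_conv4 f io_orth io_total) mxtrace_mulC !mulmxA.
by rewrite fdiag_id -mulmxA fdiag_id fdiag_mul tr_fdiag.
Qed.

Lemma total_defect_le : total_defect <= 2 * (n%:R - \sum_j dr j ^+ 2).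
Proof.
rewrite -sum_dr -sumrB mulr_sumr; apply: ler_sum => j _.
by apply: le_trans (defect_quad j) _; rewrite mulrBr mulr1 expr2.
Qed.

End Compression.

(** * Stability *)

Section Stability.
Variables (R : realType) (C : numClosedFieldType).
Variables (toC : {rmorphism R -> C}) (cabs : C -> R).
Hypothesis toC_le : forall x y, (toC x <= toC y) = (x <= y).
Hypothesis cabsE : forall z, toC (cabs z) = `|z|.
Local Notation "x %:C" := (toC x) : ring_scope.

Lemma contractionN m n (A : 'M[C]_(m, n)) : contraction A -> contraction (- A).
Proof.
move=> cA k v i; rewrite mulmxN; have -> : rownorm (- (v *m A)) i = rownorm (v *m A) i.
  by apply: eq_bigr => j _; rewrite mxE normrN.
exact: cA.
Qed.

(** The squared singular values of W - 1 sum to 2n - 2 Re tr W. *)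
Lemma unitary_trace_ge n (p e : R) (W : 'M[C]_n) : (0 < n)%N ->
  0 < p -> p <= 2 -> 0 <= e -> W \is unitarymx ->
  nsch cabs p (W - 1%:M) <= e ->
  (n%:R * (2 - 2 `^ (2 - p) * e `^ p))%:C <= \tr W + (\tr W)^*.
Proof.
move=> n0 p0 p2 e0 WU; rewrite nsch_leP // => We.
have S2 : \sum_i sv cabs (W - 1%:M) i ^+ 2 <= n%:R * (2 `^ (2 - p) * e `^ p).
  apply: (@le_trans _ _ (\sum_i 2 `^ (2 - p) * sv cabs (W - 1%:M) i `^ p)).
    apply: ler_sum => i _; have s0 := sv_ge0 cabs (W - 1%:M) i.
    (* Here s^2 = s^(2-p) s^p with s <= 2 and p <= 2. *)
    rewrite -powR_mulrn // -[X in _ `^ X](subrK p) powRD; last by apply/implyP;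
      rewrite subrK pnatr_eq0.
    rewrite ler_wpM2r ?powR_ge0 // powR_le_base ?subr_ge0 //.
    exact: (sv_unitary_sub1 toC_le cabsE).
  by rewrite -mulr_sumr mulrCA ler_wpM2l ?powR_ge0.
rewrite -toC_le (sum_sv_sqr toC_le cabsE) in S2.
have E : \sum_i rownorm (W - 1%:M) i = (n%:R * 2)%:C - (\tr W + (\tr W)^*).
  under eq_bigr do rewrite rownormB -!mulmx_adjE (unitarymxP WU) adjmx1 !mulmx1
    !mul1mx adjmxE.
  rewrite sumrB big_split /= [X in _ - X]big_split /= -rmorph_sum.
  rewrite -[\sum_i W i i]/(\tr W) -[\sum_i 1%:M i i]/(\tr (1%:M : 'M[C]_n)).
  by rewrite mxtrace1 rmorphM !rmorph_nat mulr_natr mulr2n.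
rewrite E in S2; rewrite -subr_ge0 in S2; rewrite -subr_ge0.
apply: le_trans S2 _; rewrite le_eqVlt; apply/orP; left; apply/eqP.
rewrite mulrBr rmorphB; ring.
Qed.

Lemma avg_ge (I : finType) (b : C) (z : I -> C) : (0 < #|I|)%N ->
  (forall a, b <= z a + (z a)^*) ->
  b <= #|I|%:R^-1 * \sum_a z a + (#|I|%:R^-1 * \sum_a z a)^*.
Proof.
move=> I0 H; have IC : 0 < (#|I|%:R : C) by rewrite ltr0n.
rewrite (rmorphM Num.conj) (rmorph_sum Num.conj) /=.
rewrite [_^-1^*]geC0_conj ?invr_ge0 ?ler0n // -mulrDr -big_split /=.
rewrite ler_pdivlMl // mulr_natl -sumr_const; exact: ler_sum.
Qed.

Lemma powR_le_id (p x : R) : 1 <= p -> 0 <= x -> x <= 1 -> x `^ p <= x.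
Proof.
move=> p1; rewrite le_eqVlt => /predU1P[<- _|x0 x1].
  by rewrite powR0 // gt_eqF // (lt_le_trans _ p1).
by apply: ge1r_powR => //; rewrite x0.
Qed.

(** The three moduli add up to 3u with 0 <= u <= 1, so the p-th power is at most 3^p u; the sum of
    the u is at most K. *)
Lemma diag_small3_powR n (p K : R) (M1 M2 M3 : 'M[C]_n) : 1 <= p ->
  diag_small cabs K M1 -> diag_small cabs K M2 -> diag_small cabs K M3 ->
  \sum_i cabs ((M1 + M2 + M3) i i) `^ p <= 3 `^ p * K.
Proof.
move=> p1 [A1 S1] [A2 S2] [A3 S3].
have c0 z : 0 <= cabs z := cabs_ge0 toC_le cabsE z.
apply: (@le_trans _ _ (\sum_i 3 `^ p *
    (3^-1 * (cabs (M1 i i) + cabs (M2 i i) + cabs (M3 i i))))).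
  apply: ler_sum => i _.
  have := A1 i; have := A2 i; have := A3 i.
  have := c0 (M1 i i); have := c0 (M2 i i); have := c0 (M3 i i).
  set a := cabs _; set b := cabs _; set c := cabs _ => c1 b1 a1 c2 b2 a2.
  apply: (@le_trans _ _ ((3 * (3^-1 * (c + b + a))) `^ p)).
    apply: powR_le_base => //; first by apply: le_trans p1.
    have -> : 3 * (3^-1 * (c + b + a)) = c + b + a by field.
    rewrite !mxE; apply: le_trans (cabsD toC_le cabsE _ _) _.
    by rewrite lerD2r (cabsD toC_le cabsE).
  rewrite powRM //; last by lra.
  by rewrite ler_wpM2l ?powR_ge0 // powR_le_id //; lra.
rewrite -mulr_sumr ler_wpM2l ?powR_ge0 // -mulr_sumr !big_split /=; lra.
Qed.

Lemma affine_stability (G : finGroupType) (n : nat) (p e : R) (f : G -> 'M[C]_n) :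
  (0 < n)%N -> 1 <= p -> p <= 2 -> 0 < e ->
  (forall x, f x \is unitarymx) ->
  (forall x y z w : G, (x * y^-1 * z * w^-1 = 1)%g ->
     nsch cabs p (f x *m (f y)^t* *m f z *m (f w)^t* - 1%:M) <= e) ->
  let delta := 2 `^ (2 - p) * e `^ p in
  exists m (U V : 'M[C]_(n, m)) (P : mx_representation C [set: G] m),
    [/\ ((n <= m)%N -> U \is unitarymx) /\ ((m <= n)%N -> U^t* \is unitarymx),
        ((n <= m)%N -> V \is unitarymx) /\ ((m <= n)%N -> V^t* \is unitarymx),
        forall x, P x \is unitarymx,
        `|m%:R - n%:R| <= delta * n%:R &
        forall x, nsch cabs p (f x - V *m P x *m U^t*) <= e + 3 * delta `^ p^-1].
Proof.
move=> n0 p1 p2 e0 fU fA delta.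
have p0 : 0 < p by apply: lt_le_trans p1.
have G0 : (0 < #|G|)%N by apply/card_gt0P; exists 1%g.
have GG0 : (0 < #|{: G * G}|)%N by apply/card_gt0P; exists (1%g, 1%g).
have [N [io [d [[orth tot] Fd]]]] := diagonal_frame f.
(* The average of [W w a] over [a] is h(w) f(w)^*, and (w y) (z^-1 y)^-1 z^-1 w^-1 = 1 makes each of
   them an instance of the affine relation. *)
pose W w (a : G * G) :=
  f (w * a.1)%g *m (f (a.2^-1 * a.1)%g)^t* *m f (a.2^-1)%g *m (f w)^t*.
have Weps w a : nsch cabs p (W w a - 1%:M) <= e.
  by apply: fA; rewrite invMg invgK !mulgA !mulgK mulgV.
have WU w a : W w a \is unitarymx.
  by rewrite !mul_unitarymx ?trmxC_unitary.
have smoothW w : smooth f w *m (f w)^t* = (#|{: G * G}|%:R)^-1 *: \sum_a W w a.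
  by rewrite /smooth -scalemxAl mulmx_suml.
set D := total_defect (R := R) cabs d.
(* Averaging [unitary_trace_ge] over [a] and [w] gives 2 sum d_j^2 >= (2 - delta) n. *)
have DE : D <= delta * n%:R.
  apply: le_trans (total_defect_le toC_le cabsE orth tot fU Fd) _.
  have := @avg_ge G ((n%:R * (2 - delta))%:C)
    (fun w => \tr (smooth f w *m (f w)^t*)) G0.
  rewrite -(sum_dr_sqr cabsE orth tot Fd) (conj_toC toC_le) -rmorphD.
  rewrite toC_le => H.
  suff : n%:R * (2 - delta) <= \sum_j cabs (d 0 j) ^+ 2 + \sum_j cabs (d 0 j) ^+ 2 by
    lra.
  apply: H => w; rewrite smoothW mxtraceZ raddf_sum /=; apply: avg_ge => // a.
  by apply: unitary_trace_ge => //; exact: ltW.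
have [U [V [P [HU HV HP HC]]]] := compression toC_le cabsE orth tot fU Fd.
exists (cutdim (R := R) cabs d), U, V, P; split=> //.
  have := card_dim toC_le cabsE orth tot fU Fd.
  by rewrite (sum_dr cabsE orth tot fU Fd) => /le_trans; apply.
move=> x; have [A [B [AU BU svE]]] := sv_diag toC_le cabsE (f x - V *m P x *m U^t*).
have delta0 : 0 < delta by rewrite mulr_gt0 ?powR_gt0.
have q0 : 0 < 3 * delta `^ p^-1 by rewrite mulr_gt0 ?powR_gt0.
rewrite nsch_leP //; last by rewrite addr_ge0 ?ltW.
have [M1 [M2 [M3 [ME S1 S2 S3]]]] := HC x A B AU BU.
(* This is A (f x - h x) B; the sign is moved into the right factor, still a contraction. *)
pose Q := A *m ((#|{: G * G}|%:R)^-1 *: \sum_a (W x a - 1%:M)) *m - (f x *m B).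
have split_ : A *m (f x - V *m P x *m U^t*) *m B = Q + (M1 + M2 + M3).
  have avgE : ((#|{: G * G}|%:R)^-1 *: \sum_a (W x a - 1%:M)) *m f x
      = smooth f x - f x.
    rewrite sumrB scalerBr -smoothW mulmxBl -mulmxA unitarymx_mulVmx // mulmx1.
    rewrite sumr_const -scaler_nat scalerA.
    by rewrite mulVf ?scale1r ?mul1mx // pnatr_eq0 -lt0n.
  rewrite -ME /Q mulmxN mulmxA -(mulmxA A _ (f x)) avgE -[- (_ *m B)]mulNmx
    -[- (A *m _)]mulmxN opprB.
  by rewrite -mulmxDl -mulmxDr addrA subrK.
have cA := unitarymx_contraction AU.
have cfB : contraction (- (f x *m B)).
  by apply/contractionN/unitarymx_contraction/mul_unitarymx.
have HQ := avg_diag_powR toC_le cabsE GG0 n0 p1 (ltW e0) cA cfB (Weps x).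
have HM := diag_small3_powR p1 S1 S2 S3.
apply: (@le_trans _ _ (\sum_i (cabs (Q i i) + cabs ((M1 + M2 + M3) i i)) `^ p)).
  apply: ler_sum => i _; rewrite svE split_ mxE.
  apply: powR_le_base (cabsD toC_le cabsE _ _); first exact: ltW.
  exact: (cabs_ge0 toC_le cabsE).
have c0 (M : 'M[C]_n) i : 0 <= cabs (M i i) := cabs_ge0 toC_le cabsE _.
apply: (powR_minkowski p1 (c0 Q) (c0 (M1 + M2 + M3)) e0 q0 HQ).
(* The radius 3 delta^(1/p) is chosen so that its p-th power times n is 3^p delta n. *)
apply: le_trans HM _; rewrite powRM ?powR_ge0 // -powRrM mulVf ?gt_eqF //.
rewrite powRr1 ?(ltW delta0) // [X in _ <= X]mulrCA ler_wpM2l ?powR_ge0 // mulrC.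
exact: DE.
Qed.

End Stability.

(** * Numerical constants and the case of [R[i]] *)

Local Open Scope complex_scope.

(** The root equals 2^(2/p - 1) eps. *)
Lemma schatten_delta_root (R : realType) (p eps : R) : 1 <= p -> 0 < eps ->
  (2 `^ (2 - p) * eps `^ p) `^ p^-1 <= 2 `^ (3 / p - 1) * eps.
Proof.
move=> p1 e0; have p0 : 0 < p by apply: lt_le_trans p1.
rewrite powRM ?powR_ge0 // -!powRrM divff ?gt_eqF // powRr1 ?(ltW e0) //.
rewrite ler_pM2r // ler_powR ?ler1n // mulrBl divff ?gt_eqF //.
by rewrite lerD2r ler_pM2r ?invr_gt0 // ler_nat.
Qed.

(** Here eps^p <= eps <= 1/4 and 2^(2-p) <= 2; this keeps [c] positive. *)
Lemma schatten_delta_le (R : realType) (p eps : R) : 1 <= p ->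
  0 < eps -> eps <= 1 / 4 -> 2 `^ (2 - p) * eps `^ p <= 1 / 2.
Proof.
move=> p1 e0 e4.
have H1 : eps `^ p <= 1 / 4.
  by apply: (le_trans _ e4); apply: ge1r_powR => //; rewrite e0 /=; lra.
have H2 : 2 `^ (2 - p) <= 2 :> R.
  by rewrite -[X in _ <= X]powRr1 // ler_powR ?ler1n //; lra.
have := powR_ge0 2 (2 - p); have := powR_ge0 eps p; nra.
Qed.

Theorem theorem6p9 (R : realType) (G : finGroupType) (n : nat) (p eps : R)
    (f : G -> 'M[R[i]]_n) (n_gt0 : (0 < n)%N)
    (p_ge1 : 1 <= p) (p_le2 : p <= 2)
    (eps_gt0 : 0 < eps) (eps_le : eps <= 1 / 4)
    (f_affine : affine_eps_representation p eps f) :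
  let c : R := 1 - 2 `^ (2 - p) * eps `^ p in
  let Cp : R := (2 `^ (5 - p) + 2 `^ (2 - p)) `^ p^-1 in
  exists (m : nat) (rho : G -> 'M[R[i]]_n),
    [/\ c * n%:R <= m%:R, m%:R <= c^-1 * n%:R,
        partial_affine_representation m rho &
        forall x : G,
          nschatten p (f x - rho x)
            <= (1 + 3 * 2 `^ (3 / p - 1) + 2 * Cp) * eps].
Proof.
move=> c Cp; have [fU fA] := f_affine.
pose cabs (z : R[i]) : R := complex.Re `|z|.
have cabsE z : (cabs z)%:C = `|z| by rewrite RRe_real // normr_real.
have nschE (k : nat) (X : 'M[R[i]]_k) : nsch cabs p X = nschatten p X.
  (* The eigenvalues are nonnegative, so modulus and real part agree. *)
  have svE i : sv cabs X i = singular_value X i.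
    have [d0 _] := square_svd X; rewrite /sv /singular_value /cabs.
    by congr (Num.sqrt (complex.Re _)); exact: ger0_norm (d0 i).
  by rewrite /nsch /nschatten; congr ((_ * _) `^ _); apply: eq_bigr => i _; rewrite svE.
have fA' x y z w : (x * y^-1 * z * w^-1)%g = 1%g -> 
   nsch cabs p (f x *m (f y)^t* *m f z *m (f w)^t* - 1%:M)%sesqui <= eps.
  by move=> h; rewrite nschE; exact: fA.
have toC_le (x y : R) : (real_complex R x <= real_complex R y) = (x <= y).
  exact: lecR.
have [m [U [V [P [HU HV HP mn HC]]]]] :=
  affine_stability toC_le cabsE n_gt0 p_ge1 p_le2 eps_gt0 fU fA'.
move: mn HC; set delta := 2 `^ (2 - p) * eps `^ p => mn HC.
have d_le : delta <= 1 / 2 by exact: schatten_delta_le.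
have d_ge : 0 <= delta by rewrite mulr_ge0 ?powR_ge0.
have nR : 0 <= n%:R :> R by exact: ler0n.
have c_gt0 : 0 < c by rewrite /c -/delta; lra.
move: mn; rewrite ler_distl => /andP[m_ge m_le].
exists m, (fun x => V *m P x *m (U^t*)%sesqui); split.
- by apply: le_trans m_ge; rewrite /c -/delta; lra.
- rewrite ler_pdivlMl // /c -/delta.
  (* The upper bound on m follows from (1 - delta)(1 + delta) <= 1. *)
  have : (1 - delta) * m%:R <= (1 - delta) * (n%:R + delta * n%:R).
    by rewrite ler_wpM2l //; lra.
  have : 0 <= delta * delta * n%:R by apply: mulr_ge0 => //; apply: mulr_ge0.
  lra.
- by exists U, V, P; split; [exact: HU|exact: HV|exact: HP|].
move=> x; rewrite -nschE; apply: le_trans (HC x) _.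
have := schatten_delta_root p_ge1 eps_gt0; rewrite -/delta => root_le.
have : 0 <= Cp * eps by rewrite mulr_ge0 ?powR_ge0 // ltW.
lra.
Qed.
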